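(* Let $\overline{n}=(n_1,\ldots,n_r)$ with $1\le n_1\le\cdots\le n_r$, and let $k$ be the number of indices $i$ with $2\le i\le r$ and $n_i$ even. Then $\mathrm{TC}(\mathrm{P}_{\overline{n}})<(\mathrm{TC}(\mathrm{P}^{n_1})+1)(r+k)$.
   Context: $\mathrm{P}_{\overline{n}}$ is the quotient of $S^{n_1}\times\cdots\times S^{n_r}$ by the diagonal $\mathbb{Z}_2$-action which is antipodal on each factor, and $\mathrm{P}^{n_1}$ is real projective space. $\mathrm{TC}$ denotes Farber's topological complexity in reduced form (one less than the minimal number of open sets in a cover of $X\times X$ by sets admitting continuous sections of the endpoint evaluation $X^{[0,1]}\to X\times X$). *)

(* Defs.v *)
From HB Require Import structures.
From mathcomp Require Import all_boot all_order all_algebra.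
From mathcomp Require Import generic_quotient.
From mathcomp Require Import all_classical all_reals.
From mathcomp Require Import topology normedtype.
Set Implicit Arguments. Unset Strict Implicit. Unset Printing Implicit Defensive.
Import Order.TTheory GRing.Theory Num.Theory.
Import numFieldNormedType.Exports.
Local Open Scope quotient_scope.
Local Open Scope classical_set_scope.
Local Open Scope ring_scope.

Section TC.
Context {R : realType}.

Definition unit_interval : topologicalType := set_type (`[0, 1]%classic : set R).

Definition path_space (X : topologicalType) : topologicalType :=
  set_type [set f : {compact-open, unit_interval -> X} | continuous f].

Definition has_motion_planner (X : topologicalType) (U : set (X * X)) : Prop :=
  exists s : set_type U -> path_space X,
    continuous s /\
    forall (u : set_type U) (t : unit_interval),
      (set_val t = 0 -> set_val (s u) t = (set_val u).1) /\
      (set_val t = 1 -> set_val (s u) t = (set_val u).2).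

Definition TC_le (X : topologicalType) (m : nat) : Prop :=
  exists U : 'I_m.+1 -> set (X * X),
    (forall i, open (U i)) /\
    (\bigcup_(i in [set: 'I_m.+1]) U i = [set: X * X]) /\
    (forall i, has_motion_planner (U i)).

Definition is_TC (X : topologicalType) (m : nat) : Prop :=
  TC_le X m /\ forall m', TC_le X m' -> (m <= m')%N.
End TC.

Section Spaces.
Context {R : realType}.

Unset Implicit Arguments.
Definition sphere_set (n : nat) : set 'rV[R]_n.+1 :=
  [set x | \sum_(i < n.+1) x ord0 i ^+ 2 = 1].
Set Implicit Arguments.

Definition sphere (n : nat) : topologicalType := set_type (sphere_set n).

Lemma sphere_antipode_subproof n (x : sphere n) : sphere_set n (- set_val x).
Proof.
have hx := set_valP x; rewrite /sphere_set /= in hx *.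
by rewrite -[RHS]hx; apply: eq_bigr => i _; rewrite mxE sqrrN.
Qed.

Definition sphere_antipode n (x : sphere n) : sphere n :=
  SigSub (mem_set (sphere_antipode_subproof x)).

Lemma sphere_antipodeK n : involutive (@sphere_antipode n).
Proof. by move=> x; apply: val_inj => /=; rewrite opprK. Qed.

Definition sphere_prod (r : nat) (ns : 'I_r -> nat) : topologicalType :=
  prod_topology (fun i : 'I_r => sphere (ns i)).

Definition prod_antipode (r : nat) (ns : 'I_r -> nat) (x : sphere_prod ns) : sphere_prod ns :=
  fun i => sphere_antipode (x i).

Lemma prod_antipodeK r ns : involutive (@prod_antipode r ns).
Proof.
move=> x; apply: functional_extensionality_dep => i.
by rewrite /prod_antipode sphere_antipodeK.
Qed.
End Spaces.

Section Antipodal.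
Context {T : topologicalType} (a : T -> T) (aK : involutive a).

Definition antip_rel : rel T := fun x y => `[< y = x \/ y = a x >].

Lemma antip_refl : reflexive antip_rel.
Proof. by move=> x; apply/asboolP; left. Qed.

Lemma antip_sym : symmetric antip_rel.
Proof.
move=> x y; apply/idP/idP => /asboolP h; apply/asboolP.
- by case: h => ->; [left | right; rewrite aK].
- by case: h => ->; [left | right; rewrite aK].
Qed.

Lemma antip_trans : transitive antip_rel.
Proof.
move=> y x z /asboolP hxy /asboolP hyz; apply/asboolP.
by case: hxy hyz => -> [] ->; rewrite ?aK; [left | right | right | left].
Qed.

Definition antip_equiv : equiv_rel T :=
  EquivRel antip_rel antip_refl antip_sym antip_trans.

Definition antip_quot : Type := quotient_topology {eq_quot antip_equiv}.
End Antipodal.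

Definition Pbar {R : realType} (r : nat) (ns : 'I_r -> nat) : topologicalType :=
  antip_quot (@prod_antipodeK R r ns).

Definition RP {R : realType} (n : nat) : topologicalType :=
  antip_quot (@sphere_antipodeK R n).

(* Main.v *)
Require Import Defs.
From mathcomp Require Import all_boot all_order all_algebra.
From mathcomp Require Import generic_quotient.
From mathcomp Require Import all_classical all_reals topology normedtype realfun.
From mathcomp Require Import zify ring lra.
Set Implicit Arguments. Unset Strict Implicit. Unset Printing Implicit Defensive.
Import Order.TTheory GRing.Theory Num.Theory.
Import numFieldNormedType.Exports.
Local Open Scope quotient_scope.
Local Open Scope classical_set_scope.
Local Open Scope ring_scope.

(* Let n = n_1. For each set U of a cover of P^n x P^n carrying a motion planner,
   lift the planned path from [x_1] to [y_1] to the sphere, starting at x_1: it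
   ends at e y_1 with e = +-1, which selects the representative e y of [y], in a
   way that is equivariant in x and y. On the i-th factor, i >= 2, the pairs
   (x_i, e y_i) are then joined by paths equivariant under simultaneous change
   of sign; two such planners, defined on open sets, suffice if n_i is odd and
   three if n_i is even. The planners of the r factors (one for the first factor)
   combine into product planners, on each set U, over 1 + sum of (number of
   planners - 1) = r + k open sets: as in the join construction, the products are
   grouped by the cardinality of the set of the planners whose weight exceeds
   that of all the others. *)

(** * Continuity at a point and antipodal quotients *)

(** The signs of [x] and [y] can be changed independently without changing their classes, whereas
    the natural planners on a sphere commute only with changing both. The first factor removes the
    discrepancy: once [y] is replaced by [e y], only the simultaneous change is left. The same
    constraint governs the number of planners on a sphere: joining antipodal points requires a
    direction at [y] that changes sign with [y]. A linear tangent field provides one, but on an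
    even-dimensional sphere every tangent field has a zero, and the zeros (here the poles) cost one
    more planner. The lift is made by linear algebra: a point of projective space is encoded by the
    orthogonal projector onto its line, and a path of projectors is followed by applying finitely
    many of them in turn to a vector. The number of projectors used is not a continuous choice;
    continuity of the lift is rescued by its uniqueness. *)

Lemma set_val_continuous (T : topologicalType) (A : set T) :
  continuous (set_val : set_type A -> T).
Proof. exact: initial_continuous. Qed.

Lemma fst_continuous (T U : topologicalType) : continuous (@fst T U).
Proof. by move=> z; exact: cvg_fst. Qed.

Lemma snd_continuous (T U : topologicalType) : continuous (@snd T U).
Proof. by move=> z; exact: cvg_snd. Qed.

Lemma near_fst (T U : topologicalType) (x : T) (y : U) (P : T -> Prop) :
  (\forall x' \near x, P x') -> \forall p \near (x, y), P p.1.
Proof. by move=> h; exact: (@fst_continuous T U (x, y) P h). Qed.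

Section ContinuousAt.
Context {Z : topologicalType}.
Implicit Type z : Z.

Lemma continuous_at_set_type (T : topologicalType) (A : set T)
  (f : Z -> set_type A) z :
  {for z, continuous (fun y => set_val (f y))} -> {for z, continuous f}.
Proof.
move=> h U [? [[W oW <-]] /= Wl /filterS]; apply.
by apply: h; exact: open_nbhs_nbhs.
Qed.

Lemma continuous_at_set_val (T : topologicalType) (A : set T)
  (f : Z -> set_type A) z :
  {for z, continuous f} -> {for z, continuous (fun y => set_val (f y))}.
Proof. by move=> cf; apply: (continuous_comp cf); exact: set_val_continuous. Qed.

Lemma continuous_at_prod (I : Type) (K : I -> topologicalType)
  (f : Z -> prod_topology K) z :
  (forall i, {for z, continuous (fun y => f y i)}) -> {for z, continuous f}.
Proof.
move=> h; apply/cvg_sup => i U [? [[W oW <-]] /= Wl /filterS]; apply.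
by apply: h; exact: open_nbhs_nbhs.
Qed.

(** The planners are total functions, meaningful only on an open domain and often defined by cases.
    Near a point of the domain they agree with a formula whose continuity is plain. *)
Lemma continuous_at_near_eq (T : topologicalType) (f g : Z -> T) z :
  (\forall y \near z, f y = g y) -> {for z, continuous g} ->
  {for z, continuous f}.
Proof.
move=> fg cg; rewrite /prop_for /continuous_at (nbhs_singleton fg).
by apply: cvg_trans cg; apply: near_eq_cvg; apply: filterS fg.
Qed.

Lemma continuous_at_pair (T U : topologicalType) (f : Z -> T) (g : Z -> U) z :
  {for z, continuous f} -> {for z, continuous g} ->
  {for z, continuous (fun y => (f y, g y))}.
Proof. by move=> cf cg; apply: (cvg_pair cf cg). Qed.

Lemma continuous_at_mx (R : topologicalType) m n (f : Z -> 'M[R]_(m, n)) z :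
  (forall i j, {for z, continuous (fun y => f y i j)}) -> {for z, continuous f}.
Proof.
move=> h U [P nP PU].
have Pf : nbhs z (fun y => forall ij : 'I_m * 'I_n, P ij.1 ij.2 (f y ij.1 ij.2)).
  apply: (@filter_forall _ _
    (fun (ij : 'I_m * 'I_n) y => P ij.1 ij.2 (f y ij.1 ij.2))).
  by move=> [i j]; apply: h; exact: nP.
apply: (@filterS _ (nbhs z) _ _ (f @^-1` U) _ Pf) => y Py; apply: PU => i j.
exact: (Py (i, j)).
Qed.

Lemma continuous_at_mx_coord (R : topologicalType) m n
  (f : Z -> 'M[R]_(m, n)) z i j :
  {for z, continuous f} -> {for z, continuous (fun y => f y i j)}.
Proof.
move=> h U nU; apply: (h [set M : 'M[R]_(m, n) | U (M i j)]).
exists (fun i' j' => if (i' == i) && (j' == j) then U else setT).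
  by move=> i' j'; case: ifP => [/andP[/eqP-> /eqP->]//|_]; exact: filterT.
by move=> M /(_ i j); rewrite !eqxx.
Qed.

Context {R : realType}.

Lemma continuous_atD (V : normedModType R) (f g : Z -> V) z :
  {for z, continuous f} -> {for z, continuous g} ->
  {for z, continuous (fun y => f y + g y)}.
Proof. by move=> cf cg; apply: (cvgD cf cg). Qed.

Lemma continuous_atN (V : normedModType R) (f : Z -> V) z :
  {for z, continuous f} -> {for z, continuous (fun y => - f y)}.
Proof. by move=> cf; apply: (cvgN cf). Qed.

Lemma continuous_atZ (V : normedModType R) (c : Z -> R) (f : Z -> V) z :
  {for z, continuous c} -> {for z, continuous f} ->
  {for z, continuous (fun y => c y *: f y)}.
Proof. by move=> cc cf; apply: (cvgZ cc cf). Qed.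

Lemma continuous_atM (f g : Z -> R) z :
  {for z, continuous f} -> {for z, continuous g} ->
  {for z, continuous (fun y => f y * g y)}.
Proof. by move=> cf cg; apply: (cvgM cf cg). Qed.

Lemma continuous_at_cst (T : topologicalType) (c : T) z :
  {for z, continuous (fun=> c)}.
Proof. exact: cvg_cst. Qed.

Lemma continuous_at_near_lt (f g : Z -> R) z :
  {for z, continuous f} -> {for z, continuous g} -> f z < g z ->
  \forall y \near z, f y < g y.
Proof.
move=> cf cg fg; have cd := continuous_atD cg (continuous_atN cf).
have d0 : 0 < g z - f z by rewrite subr_gt0.
by apply: filterS (cvgr_gt _ cd _ d0) => y; rewrite subr_gt0.
Qed.

Lemma continuous_at_sum (V : normedModType R) n (f : 'I_n -> Z -> V) z :
  (forall i, {for z, continuous (f i)}) ->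
  {for z, continuous (fun y => \sum_i f i y)}.
Proof.
move=> cf; apply: cvg_big => [|i _]; first exact: add_continuous.
exact: cf.
Qed.

End ContinuousAt.

Section Antipodal.
Context {T : topologicalType} (a : T -> T) (aK : involutive a).
Hypothesis ca : continuous a.

Definition antip_pi (x : T) : antip_quot aK := \pi_(antip_quot aK) x.

Lemma antip_piP x y : antip_pi x = antip_pi y <-> y = x \/ y = a x.
Proof.
by split=> [/(eqmodP (antip_equiv aK))/asboolP//|/asboolP h];
  apply/(eqmodP (antip_equiv aK)).
Qed.

Lemma antip_piA x : antip_pi (a x) = antip_pi x.
Proof. by apply/antip_piP; right; rewrite aK. Qed.

Lemma antip_repr x : repr (antip_pi x) = x \/ repr (antip_pi x) = a x.
Proof. by apply/antip_piP; rewrite /antip_pi reprK. Qed.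

Lemma antip_reprK (p : antip_quot aK) : antip_pi (repr p) = p.
Proof. by rewrite /antip_pi reprK. Qed.

Lemma antip_pi_continuous : continuous antip_pi.
Proof. exact: (@pi_continuous T {eq_quot (antip_equiv aK)}). Qed.

(** The saturation of an open [C] is the union of [C] and its preimage under [a], which is open.
    Openness of the projection serves as a substitute for a universal property of the product of two
    quotient maps. *)
Lemma antip_pi_nbhs x (B : set T) : nbhs x B ->
  nbhs (antip_pi x) (antip_pi @` B).
Proof.
rewrite nbhsE => -[C [oC Cx] CB].
apply: (@filterS _ _ _ (antip_pi @` C)); first exact: image_subset.
apply: open_nbhs_nbhs; split; last by exists x.
have : open (C `|` a @^-1` C) by apply: openU => //; move/continuousP: ca; exact.
suff -> : C `|` a @^-1` C = antip_pi @^-1` (antip_pi @` C) by [].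
rewrite eqEsubset; split => y /=.
  by case=> Cy; [exists y | exists (a y) => //; rewrite antip_piA].
case=> z Cz /antip_piP[->|->]; first by left.
by right; rewrite /= aK.
Qed.

Lemma antip_repr_continuous (U : topologicalType) (g : T -> U) :
  continuous g -> (forall x, g (a x) = g x) ->
  continuous (fun p : antip_quot aK => g (repr p)).
Proof.
move=> cg ga; apply: (@repr_comp_continuous T {eq_quot (antip_equiv aK)}) => //.
by move=> x y /eqP/antip_piP[->|->]; rewrite ?ga.
Qed.

End Antipodal.

(** * Motion planners *)

Section Clamp.
Context {R : realType}.

Definition clamp (t : R) : R := Num.max 0 (Num.min 1 t).

Lemma clamp_itv t : 0 <= clamp t <= 1.
Proof. by rewrite /clamp le_max lexx ge_max ler01 ge_min lexx. Qed.

Lemma clamp_id t : 0 <= t <= 1 -> clamp t = t.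
Proof. by move=> /andP[t0 t1]; rewrite /clamp (min_r t1) (max_r t0). Qed.

Lemma clamp_le0 t : t <= 0 -> clamp t = 0.
Proof.
by move=> t0; apply: max_l; rewrite ge_min t0 orbT.
Qed.

Lemma clamp_ge1 t : 1 <= t -> clamp t = 1.
Proof. by move=> t1; rewrite /clamp (min_l t1); apply: max_r; exact: ler01. Qed.

Lemma clamp_continuous : continuous clamp.
Proof.
move=> t; apply: (@continuous_max R R (fun=> 0) (fun x => Num.min 1 x) t).
  exact: cvg_cst.
by apply: (@continuous_min R R (fun=> 1) id t); [exact: cvg_cst|exact: cvg_id].
Qed.

Lemma clamp_unit_subproof t : (`[0, 1]%classic : set R) (clamp t).
Proof. by rewrite /= in_itv /=; exact: clamp_itv. Qed.

Definition clamp_unit (t : R) : @unit_interval R :=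
  SigSub (mem_set (clamp_unit_subproof t)).

Lemma clamp_unit_continuous : continuous clamp_unit.
Proof. by move=> t; apply: continuous_at_set_type; exact: clamp_continuous. Qed.

Lemma unit_interval_val (t : @unit_interval R) : 0 <= set_val t <= 1.
Proof. by have := set_valP t; rewrite /= in_itv. Qed.

Lemma clamp_unitK (t : @unit_interval R) : clamp_unit (set_val t) = t.
Proof. by apply: val_inj => /=; exact/clamp_id/unit_interval_val. Qed.

Lemma unit_interval_compact : compact [set: @unit_interval R].
Proof.
have -> : [set: @unit_interval R] = clamp_unit @` `[0, 1]%classic.
  rewrite eqEsubset; split=> // t _; exists (set_val t) => /=.
    by rewrite in_itv /=; exact: unit_interval_val.
  exact: clamp_unitK.
apply: continuous_compact; last exact: segment_compact.
by apply: continuous_subspaceT => t; exact: clamp_unit_continuous.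
Qed.

Lemma unit_interval_hausdorff : hausdorff_space (@unit_interval R).
Proof.
move=> s t st; apply: val_inj; apply: (@Rhausdorff R) => A B nA nB.
have [u [Au Bu]] := st (set_val @^-1` A) (set_val @^-1` B)
  (@set_val_continuous _ _ s A nA) (@set_val_continuous _ _ t B nB).
by exists (set_val u).
Qed.

End Clamp.

Section Planner.
Context {R : realType}.

(** Exponential law: the interval is compact Hausdorff, so evaluating a continuous family of paths
    is jointly continuous. Extending [H] to all pairs and all real times keeps subtypes out of the
    later constructions. *)
Lemma motion_planner_homotopy (X : topologicalType) (U : set (X * X)) :
  open U -> @has_motion_planner R X U ->
  exists H : X * X -> R -> X,
    (forall u t, U u -> {for (u, t), continuous (fun z => H z.1 z.2)}) /\
    (forall u, U u -> H u 0 = u.1 /\ H u 1 = u.2).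
Proof.
move=> oU [s [cs sE]].
pose f (u : set_type U) : {compact-open, @unit_interval R -> X} := set_val (s u).
have cf : continuous f.
  move=> u; apply: (@continuous_comp _ _ _ s set_val); first exact: cs.
  exact: initial_continuous.
have cF : continuous (uncurry f).
  apply: continuous_uncurry => //.
  - move=> t _; exists setT; first exact: filterT.
    by split; [exact: unit_interval_compact | exact: closedT].
  - exact: unit_interval_hausdorff.
  - by move=> u; exact: (set_valP (s u)).
pose H (u : X * X) (t : R) := if pselect (U u) is left Uu
  then uncurry f (SigSub (mem_set Uu), clamp_unit t) else u.1.
exists H; split.
  (* [j] sends the pairs outside [U] to the dummy value [p0]; as [U] is open, this does not affect
     continuity at a point of [U]. *)
  move=> u0 t0 Uu0; pose p0 : set_type U := SigSub (mem_set Uu0).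
  pose j (u : X * X) : set_type U :=
    if pselect (U u) is left Uu then SigSub (mem_set Uu) else p0.
  have nU : \forall z \near (u0, t0), U z.1.
    have : nbhs (u0, t0).1 U by apply: open_nbhs_nbhs.
    exact: fst_continuous.
  apply: (@continuous_at_near_eq _ _ _
    (fun z => uncurry f (j z.1, clamp_unit z.2))).
    by apply: filterS nU => z Uz; rewrite /H /j; case: pselect.
  apply: (@continuous_comp _ _ _ (fun z => (j z.1, clamp_unit z.2))
    (uncurry f)); last exact: cF.
  apply: continuous_at_pair.
    apply: continuous_at_set_type.
    apply: (@continuous_at_near_eq _ _ (fun z => set_val (j z.1)) fst).
      by apply: filterS nU => z Uz; rewrite /j; case: pselect.
    exact: fst_continuous.
  apply: (@continuous_comp _ _ _ snd clamp_unit); first exact: snd_continuous.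
  exact: clamp_unit_continuous.
move=> u Uu; rewrite /H; case: pselect => // {}Uu /=.
have e0 : set_val (@clamp_unit R 0) = 0 by apply: clamp_id; rewrite lexx ler01.
have e1 : set_val (@clamp_unit R 1) = 1 by apply: clamp_id; rewrite lexx ler01.
split; first exact: (sE (SigSub (mem_set Uu)) (clamp_unit 0)).1 e0.
exact: (sE (SigSub (mem_set Uu)) (clamp_unit 1)).2 e1.
Qed.

Lemma continuous_motion_planner (X : topologicalType) (U : set (X * X))
  (g : set_type U * @unit_interval R -> X) :
  continuous g ->
  (forall u t, (set_val t = 0 -> g (u, t) = (set_val u).1) /\
    (set_val t = 1 -> g (u, t) = (set_val u).2)) ->
  @has_motion_planner R X U.
Proof.
move=> cg gE.
exists (fun u => SigSub (mem_set ((continuous_curry cg).2 u))); split=> //.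
move=> u; apply: continuous_at_set_type => V nV.
exact: (@continuous_curry_fun _ _ _ g cg u V nV).
Qed.

Lemma TC_le_finType (X : topologicalType) (m : nat) (I : finType)
  (U : I -> set (X * X)) :
  #|I| = m.+1 -> (forall i, open (U i)) -> (forall u, exists i, U i u) ->
  (forall i, @has_motion_planner R X (U i)) -> @TC_le R X m.
Proof.
move=> cI oU cU pU; exists (fun i : 'I_m.+1 => U (enum_val (cast_ord (esym cI) i))).
split=> [i|]; first exact: oU.
split=> [|i]; last exact: pU.
rewrite eqEsubset; split=> // u _; have [i Ui] := cU u.
by exists (cast_ord cI (enum_rank i)) => //; rewrite cast_ordK enum_rankK.
Qed.

Lemma TC_le_is_TC (X : topologicalType) (m : nat) :
  @TC_le R X m -> exists n : nat, (n <= m)%N /\ @is_TC R X n.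
Proof.
move=> Xm; have exm : exists k, `[< @TC_le R X k >] by exists m; apply/asboolP.
have [n /asboolP Xn nmin] := ex_minnP exm.
exists n; split; first by apply: nmin; apply/asboolP.
by split=> // k Xk; apply: nmin; apply/asboolP.
Qed.

(** * Descent of equivariant planners to the antipodal quotient *)

Section Quotient.
Context {T : topologicalType} (a : T -> T) (aK : involutive a).
Hypothesis ca : continuous a.
Local Notation pi := (antip_pi aK).

Variables (O : set (T * T)) (phi : T * T -> R -> T).
Hypothesis oO : open O.
Hypothesis Ol : forall x y, O (x, y) -> O (a x, y).
Hypothesis Or : forall x y, O (x, y) -> O (x, a y).
Hypothesis phic : forall z t, O z -> {for (z, t), continuous (fun z => phi z.1 z.2)}.
Hypothesis phi0 : forall z, O z -> phi z 0 = z.1.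
Hypothesis phi1 : forall z, O z -> phi z 1 = z.2 \/ phi z 1 = a z.2.
Hypothesis phil : forall x y t, O (x, y) -> phi (a x, y) t = a (phi (x, y) t).
Hypothesis phir : forall x y t, O (x, y) -> phi (x, a y) t = phi (x, y) t.

Definition antip_image : set (antip_quot aK * antip_quot aK) :=
  [set u | O (repr u.1, repr u.2)].

Let O_repr x y : O (x, y) -> antip_image (pi x, pi y).
Proof.
rewrite /antip_image /= => Oxy.
have [->|->] := antip_repr aK x; have [->|->] := antip_repr aK y => //.
- exact: Or.
- exact: Ol.
- exact/Or/Ol.
Qed.

Let phi_repr x y t : O (x, y) ->
  pi (phi (repr (pi x), repr (pi y)) t) = pi (phi (x, y) t).
Proof.
move=> Oxy.
have [->|->] := antip_repr aK x; have [->|->] := antip_repr aK y => //.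
- by rewrite phir.
- by rewrite phil // antip_piA.
- by rewrite phir ?phil ?antip_piA //; exact: Ol.
Qed.

Lemma antip_image_open : open antip_image.
Proof.
rewrite openE => -[p q]; rewrite /antip_image /= => Opq.
have : nbhs (repr p, repr q) O by apply: open_nbhs_nbhs.
move=> [[A B] /= [nA nB] AB].
exists (pi @` A, pi @` B) => /=.
  by rewrite -{1}(antip_reprK p) -{1}(antip_reprK q); split;
    exact: antip_pi_nbhs.
by move=> [_ _] /= [[x Ax <-] [y By <-]]; apply: O_repr; exact: (AB (x, y)).
Qed.

(** Changing the sign of [x] moves the whole path by [a], changing that of [y] leaves it alone, and
    [pi] forgets both, so the projected path depends on the classes only. Continuity is checked near
    the chosen representatives, which need not vary continuously: since [pi] is open, neighbourhoods
    of them project to neighbourhoods of the classes. *)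
Lemma antip_image_planner : @has_motion_planner R (antip_quot aK) antip_image.
Proof.
pose g (z : set_type antip_image * @unit_interval R) : antip_quot aK :=
  pi (phi (repr (set_val z.1).1, repr (set_val z.1).2) (set_val z.2)).
have cg : continuous g.
  move=> [u t] V nV; have Ou := set_valP u.
  set x := repr (set_val u).1; set y := repr (set_val u).2.
  have c1 : {for ((x, y), set_val t), continuous (fun z => pi (phi z.1 z.2))}.
    apply: (@continuous_comp _ _ _ (fun z => phi z.1 z.2) pi).
      exact: phic.
    exact: antip_pi_continuous.
  have nO : nbhs ((x, y), set_val t) [set z | O z.1].
    have : nbhs ((x, y), set_val t).1 O by apply: open_nbhs_nbhs.
    exact: fst_continuous.
  have nV' : nbhs ((x, y), set_val t) [set z | V (pi (phi z.1 z.2))].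
    exact: c1.
  have [[AB C] [[[A B] /= [nA nB] AAB] nC] ABC] := filterI nV' nO.
  pose P : set (antip_quot aK * antip_quot aK) := (pi @` A) `*` (pi @` B).
  have nP : nbhs (set_val u) P.
    exists (pi @` A, pi @` B) => //=; rewrite -(antip_reprK (set_val u).1).
    by rewrite -(antip_reprK (set_val u).2); split; exact: antip_pi_nbhs.
  exists (set_val @^-1` P, set_val @^-1` C) => /=.
    by split; exact: (@set_val_continuous _ _).
  move=> [v s] /= [[[x' Ax' xv] [y' By' yv]] Cs].
  have [/= Vxy Oxy] := ABC ((x', y'), set_val s)
    (conj (AAB (x', y') (conj Ax' By')) Cs).
  by rewrite /g /= -xv -yv phi_repr.
apply: (continuous_motion_planner cg) => u t; have Ou := set_valP u.
split => t01; rewrite /g /= t01.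
  by rewrite phi0 // antip_reprK.
by have [->|->] := phi1 Ou; rewrite ?antip_piA antip_reprK.
Qed.

End Quotient.
End Planner.

(** * Equivariant motion planning on spheres *)

Section Euclid.
Context {R : realType}.

Definition dot n (x y : 'rV[R]_n) : R := \sum_i x ord0 i * y ord0 i.

Lemma dotC n (x y : 'rV[R]_n) : dot x y = dot y x.
Proof. by apply: eq_bigr => i _; rewrite mulrC. Qed.

Lemma dotDl n (x y z : 'rV[R]_n) : dot (x + y) z = dot x z + dot y z.
Proof. by rewrite -big_split; apply: eq_bigr => i _; rewrite mxE mulrDl. Qed.

Lemma dotZl n c (x y : 'rV[R]_n) : dot (c *: x) y = c * dot x y.
Proof. by rewrite mulr_sumr; apply: eq_bigr => i _; rewrite mxE mulrA. Qed.

Lemma dotNl n (x y : 'rV[R]_n) : dot (- x) y = - dot x y.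
Proof. by rewrite -scaleN1r dotZl mulN1r. Qed.

Lemma dot0l n (y : 'rV[R]_n) : dot 0 y = 0.
Proof. by rewrite -(scale0r 0) dotZl mul0r. Qed.

Lemma dotDr n (x y z : 'rV[R]_n) : dot z (x + y) = dot z x + dot z y.
Proof. by rewrite dotC dotDl !(dotC z). Qed.

Lemma dotZr n c (x y : 'rV[R]_n) : dot y (c *: x) = c * dot y x.
Proof. by rewrite dotC dotZl (dotC y). Qed.

Lemma dotNr n (x y : 'rV[R]_n) : dot y (- x) = - dot y x.
Proof. by rewrite dotC dotNl (dotC y). Qed.

Lemma dot_ge0 n (x : 'rV[R]_n) : 0 <= dot x x.
Proof. by apply: sumr_ge0 => i _; rewrite -expr2 sqr_ge0. Qed.

Lemma dot_eq0 n (x : 'rV[R]_n) : (dot x x == 0) = (x == 0).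
Proof.
apply/idP/eqP => [|->]; last by rewrite dot0l.
rewrite psumr_eq0 => [|i _]; last by rewrite -expr2 sqr_ge0.
move=> /allP h; apply/rowP => i; rewrite mxE.
by have := h i (mem_index_enum i); rewrite -expr2 sqrf_eq0 => /eqP.
Qed.

Lemma dot_gt0 n (x : 'rV[R]_n) : (0 < dot x x) = (x != 0).
Proof. by rewrite lt_neqAle dot_ge0 andbT eq_sym dot_eq0. Qed.

Lemma mulmx_tr_dot n (x y : 'rV[R]_n) : x *m y^T = (dot x y)%:M.
Proof.
apply/matrixP => i j; rewrite !ord1 !mxE mulr1n.
by apply: eq_bigr => k _; rewrite mxE.
Qed.

Lemma dot_continuous (Z : topologicalType) n (f g : Z -> 'rV[R]_n) (z : Z) :
  {for z, continuous f} -> {for z, continuous g} ->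
  {for z, continuous (fun y => dot (f y) (g y))}.
Proof.
move=> cf cg; apply: continuous_at_sum => i.
by apply: continuous_atM; exact: continuous_at_mx_coord.
Qed.

Lemma mulmx_continuous_at (Z : topologicalType) m n p (f : Z -> 'M[R]_(m, n))
  (g : Z -> 'M[R]_(n, p)) (z : Z) :
  {for z, continuous f} -> {for z, continuous g} ->
  {for z, continuous (fun y => f y *m g y)}.
Proof.
move=> cf cg; apply: continuous_at_mx => i j.
rewrite (_ : (fun y => _) = fun y => \sum_k f y i k * g y k j); last first.
  by apply/funext => y; rewrite mxE.
apply: continuous_at_sum => k.
by apply: continuous_atM; exact: continuous_at_mx_coord.
Qed.

(** The value at the zero vector is an arbitrary unit vector, so that [to_sphere] is total;
    continuity is claimed only away from zero. *)
Definition normalize n (v : 'rV[R]_n.+1) : 'rV[R]_n.+1 :=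
  if v == 0 then delta_mx 0 0 else (Num.sqrt (dot v v))^-1 *: v.

Lemma normalizeP n (v : 'rV[R]_n.+1) : sphere_set n (normalize v).
Proof.
rewrite /sphere_set /=.
transitivity (dot (normalize v) (normalize v)).
  by apply: eq_bigr => i _; rewrite expr2.
rewrite /normalize; case: eqVneq => [_|v0].
  rewrite /dot (bigD1 ord0) //= big1 ?addr0 => [|i i0].
    by rewrite mxE !eqxx mulr1.
  by rewrite mxE (negPf i0) andbF mul0r.
rewrite dotZl dotZr mulrA -invfM -expr2 sqr_sqrtr ?dot_ge0 //.
by rewrite mulVf // dot_eq0.
Qed.

Definition to_sphere n (v : 'rV[R]_n.+1) : @sphere R n :=
  SigSub (mem_set (normalizeP v)).

Lemma sphere_dot n (x : @sphere R n) : dot (set_val x) (set_val x) = 1.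
Proof.
by rewrite -[RHS](set_valP x); apply: eq_bigr => i _; rewrite expr2.
Qed.

Lemma to_sphereZ n (c : R) (x : @sphere R n) : 0 < c ->
  to_sphere (c *: set_val x) = x.
Proof.
move=> c0; apply: val_inj; rewrite /= /normalize.
have x0 : set_val x != 0 by rewrite -dot_gt0 sphere_dot ltr01.
rewrite scaler_eq0 gt_eqF //= (negPf x0) dotZl dotZr sphere_dot mulr1 -expr2.
by rewrite sqrtr_sqr gtr0_norm // scalerA mulVf ?scale1r // gt_eqF.
Qed.

Lemma to_sphereK n (x : @sphere R n) : to_sphere (set_val x) = x.
Proof. by rewrite -[set_val x]scale1r to_sphereZ // ltr01. Qed.

Lemma to_sphereN n (v : 'rV[R]_n.+1) : v != 0 ->
  to_sphere (- v) = sphere_antipode (to_sphere v).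
Proof.
move=> v0; apply: val_inj => /=.
rewrite [RHS]/(- normalize v) /normalize oppr_eq0 (negPf v0).
by rewrite dotNl dotNr opprK scalerN.
Qed.

Lemma to_sphere_continuous (Z : topologicalType) n (f : Z -> 'rV[R]_n.+1)
  (z : Z) : {for z, continuous f} -> f z != 0 ->
  {for z, continuous (fun y => to_sphere (f y))}.
Proof.
move=> cf fz0; have cd := dot_continuous cf cf.
apply: continuous_at_set_type; apply: (@continuous_at_near_eq _ _ _
  (fun y => (Num.sqrt (dot (f y) (f y)))^-1 *: f y)).
  have nf : \forall y \near z, 0 < dot (f y) (f y).
    have dz : dot (f z) (f z) > 0 by rewrite dot_gt0.
    exact: (cvgr_gt _ cd _ dz).
  by apply: filterS nf => y; rewrite dot_gt0 => /negPf fy0;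
    rewrite -[LHS]/(normalize (f y)) /normalize fy0.
apply: continuous_atZ => //; apply: cvgV.
  by rewrite gt_eqF // sqrtr_gt0 dot_gt0.
by apply: continuous_cvg => //; exact: sqrt_continuous.
Qed.

Lemma sphere_antipode_continuous n : continuous (@sphere_antipode R n).
Proof.
move=> x; apply: continuous_at_set_type.
have cN : {for x, continuous (fun y : @sphere R n => - set_val y)}.
  by apply: continuous_atN; exact: set_val_continuous.
exact: cN.
Qed.

Lemma sphere_prod_coord_continuous r (ns : 'I_r -> nat) i :
  continuous (fun x : @sphere_prod R r ns => x i).
Proof. exact: (@proj_continuous _ (fun i => @sphere R (ns i)) i). Qed.

Lemma prod_antipode_continuous r (ns : 'I_r -> nat) :
  continuous (@prod_antipode R r ns).
Proof.
move=> x; apply: continuous_at_prod => i.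
apply: (@continuous_comp _ _ _ (fun y : @sphere_prod R r ns => y i)
  (@sphere_antipode R (ns i))); last exact: sphere_antipode_continuous.
exact: sphere_prod_coord_continuous.
Qed.

End Euclid.

(** * Polygonal paths avoiding the origin *)

Section Polyline.
Context {R : realType} {n : nat}.
Implicit Types (w : nat -> 'rV[R]_n) (t : R).

(** The vertex [w k] is reached at time [k]. Writing the path as a single sum of clamped increments
    makes it continuous jointly in time and vertices, without gluing. *)
Definition polyline m w t : 'rV[R]_n :=
  w 0%N + \sum_(k < m) clamp (t - k%:R) *: (w k.+1 - w k).

Lemma polyline_ge m w t : m%:R <= t -> polyline m w t = w m.
Proof.
elim: m => [|m IH] mt; first by rewrite /polyline big_ord0 addr0.
rewrite /polyline big_ord_recr /= addrA -/(polyline m w t) IH; last first.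
  by apply: le_trans mt; rewrite ler_nat.
rewrite clamp_ge1; last by rewrite lerBrDr nat1r.
by rewrite scale1r addrC subrK.
Qed.

Lemma polyline0 m w : polyline m w 0 = w 0%N.
Proof.
rewrite /polyline big1 ?addr0 // => k _.
by rewrite clamp_le0 ?scale0r // sub0r oppr_le0.
Qed.

Lemma polyline_segment m w t : exists k s, [/\ (k < m.+1)%N, 0 <= s <= 1 &
  polyline m.+1 w t = w k + s *: (w k.+1 - w k)].
Proof.
elim: m => [|m [k [s [km s01 IH]]]].
  exists 0%N, (clamp t); rewrite clamp_itv; split=> //.
  by rewrite /polyline big_ord_recr big_ord0 /= add0r subr0.
have [tm|tm] := leP t m.+1%:R.
  exists k, s; split=> //; first exact: ltnW.
  rewrite /polyline big_ord_recr /= addrA -/(polyline m.+1 w t).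
  by rewrite clamp_le0 ?subr_le0 // scale0r addr0.
exists m.+1, (clamp (t - m.+1%:R)); rewrite clamp_itv; split=> //.
rewrite /polyline big_ord_recr /= addrA -/(polyline m.+1 w t).
by rewrite polyline_ge // ltW.
Qed.

Lemma polylineN m w w' t : (forall k, w' k = - w k) ->
  polyline m w' t = - polyline m w t.
Proof.
move=> ww'; rewrite /polyline ww' opprD; congr (_ + _).
rewrite -sumrN; apply: eq_bigr => k _.
by rewrite !ww' -opprD scalerN.
Qed.

Lemma polyline_continuous (Z : topologicalType) m (w : Z -> nat -> 'rV[R]_n)
  (t : Z -> R) (z : Z) : (forall k, {for z, continuous (w ^~ k)}) ->
  {for z, continuous t} ->
  {for z, continuous (fun y => polyline m (w y) (t y))}.
Proof.
move=> cw ct; apply: continuous_atD; first exact: cw.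
apply: continuous_at_sum => k.
apply: continuous_atZ; last first.
  by apply: continuous_atD; [|apply: continuous_atN]; exact: cw.
apply: (@continuous_comp _ _ _ (fun y => t y - k%:R) clamp).
  by apply: continuous_atD; [exact: ct | exact: continuous_at_cst].
exact: clamp_continuous.
Qed.

Definition segment_neq0 (a b : 'rV[R]_n) :=
  forall s, 0 <= s <= 1 -> a + s *: (b - a) != 0.

(** Pairing a zero of the segment with [a] gives [(1 - s) * dot a a + s * dot a b = 0] with both
    terms nonnegative. Hence [s = 1], and the zero is [b] itself. *)
Lemma segment_neq0_dot a b : a != 0 -> b != 0 -> 0 <= dot a b ->
  segment_neq0 a b.
Proof.
move=> a0 b0 ab s /andP[s0 s1]; apply/eqP => e.
have /eqP := congr1 (dot a) e.
rewrite dotDr dotZr dotDr dotNr [dot a 0]dotC dot0l.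
have -> : dot a a + s * (dot a b - dot a a) = (1 - s) * dot a a + s * dot a b.
  by rewrite mulrBr mulrBl mul1r addrA addrAC.
rewrite paddr_eq0 ?mulr_ge0 ?subr_ge0 ?dot_ge0 // => /andP[].
rewrite mulf_eq0 dot_eq0 (negPf a0) orbF subr_eq0 => /eqP s1' _.
by move: e b0; rewrite -s1' scale1r addrC subrK => ->; rewrite eqxx.
Qed.

(** For unit vectors [b - a] is orthogonal to [a + b], so the pairing with [a + b] is constantly
    [1 + dot a b] along the segment. *)
Lemma segment_neq0_unit a b : dot a a = 1 -> dot b b = 1 -> -1 < dot a b ->
  segment_neq0 a b.
Proof.
move=> a1 b1 ab s _; apply/eqP => /(congr1 (dot (a + b))).
rewrite !(dotDl, dotDr, dotZr, dotNr) a1 b1 (dotC b a) !(dotC _ 0) !dot0l.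
move=> e; suff : 1 + dot a b = 0 by lra.
by rewrite -[RHS]addr0 -e; ring.
Qed.

End Polyline.

Section SpherePlanner.
Context {R : realType} {n : nat}.
Implicit Types x y : 'rV[R]_n.+1.

(* [y *m skewJ] is tangent to the sphere at [y]; it vanishes nowhere if [n] is
   odd, and only at the two poles [y = (0, ..., 0, +-1)] if [n] is even. *)
Definition skewJ : 'M[R]_n.+1 := \matrix_(i, j)
  (((j == i.+1 :> nat) && odd j)%:R - ((i == j.+1 :> nat) && odd i)%:R).

Lemma dot_skewJ y : dot y (y *m skewJ) = 0.
Proof.
have JT : skewJ^T = - skewJ by apply/matrixP => i j; rewrite !mxE opprB.
have /matrixP/(_ ord0 ord0) := mulmx_tr_dot y (y *m skewJ).
rewrite trmx_mul JT mulNmx mulmxN mulmxA.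
have -> : y *m skewJ *m y^T = (dot (y *m skewJ) y)%:M by rewrite mulmx_tr_dot.
by rewrite !mxE !mulr1n dotC; lra.
Qed.

(** [skewJ] pairs the coordinates 0 and 1, 2 and 3, and so on, so each paired coordinate of [y]
    reappears, up to sign, as the partner coordinate of [y *m skewJ]. The condition on [i] says that
    it has a partner: only [i = n] with [n] even has none. *)
Lemma skewJ_eq0 y : y *m skewJ = 0 ->
  forall i : 'I_n.+1, (i < n)%N || odd n -> y ord0 i = 0.
Proof.
move=> yJ i ni; have [oi|ei] := boolP (odd i).
  have i0 : (0 < i)%N by case: (nat_of_ord i) oi.
  have kP : (i.-1 < n.+1)%N by rewrite (leq_ltn_trans (leq_pred _) (ltn_ord i)).
  have := congr1 (fun M : 'rV_n.+1 => M ord0 (Ordinal kP)) yJ.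
  rewrite !mxE (bigD1 i) //= !mxE /= prednK // eqxx oi /= big1 => [|j ji].
    rewrite addr0 (_ : (i.-1 == i.+1) = false) ?mulr0n ?mulr1n; first by lra.
    by apply/negP => /eqP; lia.
  rewrite !mxE /= prednK //.
  have -> : (j == i :> nat) = false by apply/negP => /eqP/val_inj/eqP; apply/negP.
  have -> : odd i.-1 = false by move: oi; rewrite -{1}(prednK i0) /= => /negbTE.
  by rewrite andbF subrr mulr0.
have kP : (i.+1 < n.+1)%N.
  rewrite ltnS; case/orP: ni => // on; rewrite ltn_neqAle -ltnS ltn_ord andbT.
  by apply: contraNneq ei => ->.
have := congr1 (fun M : 'rV_n.+1 => M ord0 (Ordinal kP)) yJ.
rewrite !mxE (bigD1 i) //= !mxE /= eqxx ei /= big1 => [|j ji].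
  by rewrite addr0 (negPf ei) andbF mulr0n mulr1n; lra.
rewrite !mxE /= eqSS.
have -> : (i == j :> nat) = false.
  by apply/negP => /eqP/val_inj/esym/eqP; apply/negP.
rewrite /= sub0r; case: eqP => [->|_]; last by rewrite oppr0 mulr0.
by rewrite /= (negPf ei) oppr0 mulr0.
Qed.

Definition pole : 'rV[R]_n.+1 := delta_mx ord0 ord_max.
Definition equator_pt : 'rV[R]_n.+1 := delta_mx ord0 ord0.

(* The [l]-th planner moves straight from [x] to [y] ([l = 0]), through [- y]
   ([l = 1]), or through the poles nearest to [x] and [y] ([l = 2]); it is
   defined where [weight l x y] is positive. *)
Definition weight (l : nat) x y : R :=
  match l with
  | 0 => 1 + dot x y
  | 1 => (1 - dot x y) * dot (y *m skewJ) (y *m skewJ)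
  | _ => if odd n then 0 else - (x ord0 ord_max * y ord0 ord_max)
  end.

(** Each list is continued by [y], so that all planners have four segments. In the last one the
    equator point is scaled by the last coordinate of [x]: a fixed point there would not change sign
    with [(x, y)]. *)
Definition waypoint (l : nat) x y (k : nat) : 'rV[R]_n.+1 :=
  match l with
  | 0 => if k == 0%N then x else y
  | 1 => nth y [:: x; - y; y *m skewJ] k
  | _ => nth y [:: x; x ord0 ord_max *: pole; x ord0 ord_max *: equator_pt;
                  y ord0 ord_max *: pole] k
  end.

Lemma weightNN l x y : weight l (- x) (- y) = weight l x y.
Proof.
case: l => [|[|l]] /=; rewrite ?mulNmx ?dotNl ?dotNr ?opprK //.
by rewrite !mxE mulrNN.
Qed.

Lemma waypointNN l x y k : waypoint l (- x) (- y) k = - waypoint l x y k.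
Proof.
case: l => [|[|l]] /=; first by case: eqP.
  by case: k => [|[|[|k]]] //=; rewrite ?nth_nil // mulNmx.
by case: k => [|[|[|[|k]]]] //=; rewrite ?nth_nil // !mxE scaleNr.
Qed.

Lemma waypoint0 l x y : waypoint l x y 0 = x.
Proof. by case: l => [|[|l]]. Qed.

Lemma waypoint4 l x y : waypoint l x y 4 = y.
Proof. by case: l => [|[|l]]. Qed.

Lemma weight_oob l x y : (l < 3)%N -> ~~ (l < 2 + ~~ odd n)%N ->
  weight l x y = 0.
Proof. by case: l => [|[|[|l]]] //=; case: (odd n). Qed.

Lemma dot_delta x (i : 'I_n.+1) : dot x (delta_mx ord0 i) = x ord0 i.
Proof.
rewrite /dot (bigD1 i) //= big1 ?addr0 => [|j ji].
  by rewrite mxE !eqxx mulr1.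
by rewrite mxE (negPf ji) andbF mulr0.
Qed.

(** The first weight vanishes only at [x = - y]. There the second is twice the squared norm of
    [y *m skewJ], which vanishes only if [n] is even and [y] is a pole; the third is then the square
    of the last coordinate of [y], that is 1. *)
Lemma weight_cover x y : dot x x = 1 -> dot y y = 1 ->
  exists2 l, (l < 2 + ~~ odd n)%N & 0 < weight l x y.
Proof.
move=> x1 y1.
have xy2 : dot (x + y) (x + y) = 2 + 2 * dot x y.
  by rewrite !(dotDl, dotDr) x1 y1 (dotC y x); ring.
have [p|p] := ltP 0 (1 + dot x y); first by exists 0%N.
have xy : x = - y.
  by apply/eqP; rewrite -addr_eq0 -dot_eq0 eq_le dot_ge0 xy2; lra.
have [J0|J0] := eqVneq (y *m skewJ) 0; last first.
  exists 1%N => //=; rewrite mulr_gt0 ?dot_gt0 //; lra.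
have en : ~~ odd n.
  apply/negP => on; have : dot y y = 0; last by lra.
  by apply: big1 => i _; rewrite (skewJ_eq0 J0) ?on ?orbT ?mul0r.
exists 2%N; first by rewrite en.
rewrite /= (negPf en) xy mxE mulNr opprK.
suff -> : y ord0 ord_max * y ord0 ord_max = 1 by [].
rewrite -y1 /dot (bigD1 ord_max) //= big1 ?addr0 // => i im.
rewrite (skewJ_eq0 J0) ?mul0r //.
by rewrite ltn_neqAle -ltnS ltn_ord andbT; apply/orP; left.
Qed.

Lemma waypoint_segment l x y k : (0 < n)%N -> dot x x = 1 -> dot y y = 1 ->
  0 < weight l x y -> segment_neq0 (waypoint l x y k) (waypoint l x y k.+1).
Proof.
move=> n0 x1 y1.
have x0 : x != 0 by rewrite -dot_gt0 x1.
have y0 : y != 0 by rewrite -dot_gt0 y1.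
have yy : segment_neq0 y y by apply: segment_neq0_dot; rewrite ?dot_ge0.
case: l => [|[|l]] /=.
- move=> xy; case: eqP => //= _; apply: segment_neq0_unit => //; lra.
- move=> w0.
  have J0 : y *m skewJ != 0.
    by apply: contraTneq w0 => ->; rewrite dot0l mulr0 ltxx.
  have xy : dot x y < 1.
    by move: w0; rewrite pmulr_lgt0 ?dot_gt0 // subr_gt0.
  case: k => [|[|[|k]]] //=.
  + by apply: segment_neq0_unit; rewrite ?dotNl ?dotNr ?opprK // ltrN2.
  + by apply: segment_neq0_dot; rewrite ?oppr_eq0 // dotNl dot_skewJ oppr0.
  + by apply: segment_neq0_dot; rewrite // dotC dot_skewJ.
  + by rewrite !nth_nil.
- case: ifP => [_|_ w0]; first by rewrite ltxx.
  have xm : x ord0 ord_max != 0.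
    by apply: contraTneq w0 => ->; rewrite mul0r oppr0 ltxx.
  have ym : y ord0 ord_max != 0.
    by apply: contraTneq w0 => ->; rewrite mulr0 oppr0 ltxx.
  have d1 (i : 'I_n.+1) : (delta_mx ord0 i : 'rV[R]_n.+1) != 0.
    by rewrite -dot_gt0 dot_delta mxE !eqxx.
  (* Here [0 < n] enters: for [n = 0] the pole and the equator point would coincide. *)
  have em : (ord0 == ord_max :> 'I_n.+1) = false by apply/negP => /eqP[]; lia.
  case: k => [|[|[|[|k]]]] /=.
  + apply: segment_neq0_dot; rewrite ?scaler_eq0 ?negb_or ?xm ?d1 //.
    by rewrite dotZr dot_delta -expr2 sqr_ge0.
  + apply: segment_neq0_dot; rewrite ?scaler_eq0 ?negb_or ?xm ?d1 //.
    by rewrite dotZr dotZl dot_delta mxE em andbF !mulr0.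
  + apply: segment_neq0_dot; rewrite ?scaler_eq0 ?negb_or ?xm ?ym ?d1 //.
    by rewrite dotZr dotZl dot_delta mxE eq_sym em andbF !mulr0.
  + apply: segment_neq0_dot; rewrite ?scaler_eq0 ?negb_or ?ym ?d1 //.
    by rewrite dotC dotZr dot_delta -expr2 sqr_ge0.
  + by rewrite !nth_nil.
Qed.

Lemma weight_continuous (Z : topologicalType) l (f g : Z -> 'rV[R]_n.+1) z :
  {for z, continuous f} -> {for z, continuous g} ->
  {for z, continuous (fun u => weight l (f u) (g u))}.
Proof.
move=> cf cg; have cfg := dot_continuous cf cg.
have cJ : {for z, continuous (fun u => g u *m skewJ)}.
  by apply: mulmx_continuous_at; [exact: cg | exact: continuous_at_cst].
case: l => [|[|l]] /=.
- by apply: continuous_atD => //; exact: continuous_at_cst.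
- apply: continuous_atM; last exact: dot_continuous.
  by apply: continuous_atD; [exact: continuous_at_cst | exact: continuous_atN].
- case: (odd n); first exact: continuous_at_cst.
  by apply: continuous_atN; apply: continuous_atM; exact: continuous_at_mx_coord.
Qed.

Lemma waypoint_continuous (Z : topologicalType) l k (f g : Z -> 'rV[R]_n.+1) z :
  {for z, continuous f} -> {for z, continuous g} ->
  {for z, continuous (fun u => waypoint l (f u) (g u) k)}.
Proof.
move=> cf cg.
have cJ : {for z, continuous (fun u => g u *m skewJ)}.
  by apply: mulmx_continuous_at; [exact: cg | exact: continuous_at_cst].
have cZ (h : Z -> 'rV[R]_n.+1) (e : 'rV[R]_n.+1) : {for z, continuous h} ->
    {for z, continuous (fun u => h u ord0 ord_max *: e)}.
  move=> ch; apply: continuous_atZ; last exact: continuous_at_cst.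
  exact: continuous_at_mx_coord.
case: l => [|[|l]] /=; first by case: (k == 0%N).
- case: k => [|[|[|k]]] /=; [exact: cf | exact: continuous_atN | exact: cJ |].
  rewrite (_ : (fun u => _) = g); last by apply/funext => u; rewrite nth_nil.
  exact: cg.
- case: k => [|[|[|[|k]]]] /=; [exact: cf | exact: cZ | exact: cZ | exact: cZ |].
  rewrite (_ : (fun u => _) = g); last by apply/funext => u; rewrite nth_nil.
  exact: cg.
Qed.

Definition sphere_path l (x y : @sphere R n) (t : R) : @sphere R n :=
  to_sphere (polyline 4 (waypoint l (set_val x) (set_val y)) (4 * t)).

Lemma sphere_path0 l (x y : @sphere R n) : sphere_path l x y 0 = x.
Proof. by rewrite /sphere_path mulr0 polyline0 waypoint0 to_sphereK. Qed.

Lemma sphere_path1 l (x y : @sphere R n) : sphere_path l x y 1 = y.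
Proof. by rewrite /sphere_path mulr1 polyline_ge ?waypoint4 ?to_sphereK. Qed.

Hypothesis n_gt0 : (0 < n)%N.

Lemma sphere_polyline_neq0 l (x y : @sphere R n) t :
  0 < weight l (set_val x) (set_val y) ->
  polyline 4 (waypoint l (set_val x) (set_val y)) t != 0.
Proof.
move=> w0.
have [k [s [_ s01 ->]]] :=
  polyline_segment 3 (waypoint l (set_val x) (set_val y)) t.
by apply: waypoint_segment => //; exact: sphere_dot.
Qed.

Lemma sphere_pathNN l (x y : @sphere R n) t :
  0 < weight l (set_val x) (set_val y) ->
  sphere_path l (sphere_antipode x) (sphere_antipode y) t =
  sphere_antipode (sphere_path l x y t).
Proof.
move=> w0; rewrite -to_sphereN ?sphere_polyline_neq0 //.
by congr to_sphere; apply: polylineN => k; exact: waypointNN.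
Qed.

Lemma sphere_path_continuous (Z : topologicalType) l (f g : Z -> @sphere R n)
  (t : Z -> R) z : {for z, continuous f} -> {for z, continuous g} ->
  {for z, continuous t} -> 0 < weight l (set_val (f z)) (set_val (g z)) ->
  {for z, continuous (fun u => sphere_path l (f u) (g u) (t u))}.
Proof.
move=> cf cg ct w0; apply: to_sphere_continuous; last exact: sphere_polyline_neq0.
apply: polyline_continuous => [k|].
  by apply: waypoint_continuous; exact: continuous_at_set_val.
apply: continuous_atM; [exact: continuous_at_cst | exact: ct].
Qed.

End SpherePlanner.

(** * Lifting paths of lines to the sphere *)

Section Lift.
Context {R : realType} {n : nat}.
Implicit Types (u v x : @sphere R n) (m : R -> 'M[R]_n.+1).

(** The orthogonal projector onto the line spanned by [u], acting on row vectors. It embeds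
    projective space into the matrices. *)
Definition line u : 'M[R]_n.+1 := (set_val u)^T *m set_val u.

Lemma line_antipode u : line (sphere_antipode u) = line u.
Proof.
rewrite /line -[set_val (sphere_antipode u)]/(- set_val u) mulmxN.
by rewrite linearN /= mulNmx opprK.
Qed.

Lemma mulmx_line u v :
  set_val u *m line v = dot (set_val u) (set_val v) *: set_val v.
Proof. by rewrite mulmxA mulmx_tr_dot mul_scalar_mx. Qed.

(** A squared cosine: positivity of the trace tests that two lines are not orthogonal, without
    choosing a sign on either. *)
Lemma mxtrace_line u v :
  \tr (line u *m line v) = dot (set_val u) (set_val v) ^+ 2.
Proof.
rewrite -mulmxA mulmx_line -scalemxAr mxtraceZ mxtrace_mulC mulmx_tr_dot.
by rewrite mxtrace_scalar mulr1n dotC expr2.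
Qed.

Lemma line_to_sphereZ (c : R) u : c != 0 ->
  line (to_sphere (c *: set_val u)) = line u.
Proof.
move=> c0; have [cp|] := ltP 0 c; first by rewrite to_sphereZ.
rewrite le_eqVlt (negPf c0) /= => cn.
have -> : c *: set_val u = - ((- c) *: set_val u) by rewrite scaleNr opprK.
rewrite to_sphereN ?line_antipode ?to_sphereZ ?oppr_gt0 //.
by rewrite scaler_eq0 oppr_eq0 (negPf c0) /= -dot_gt0 sphere_dot ltr01.
Qed.

Lemma line_inj u v : line u = line v -> 0 < dot (set_val u) (set_val v) -> u = v.
Proof.
move=> uv d0; apply: val_inj; apply/eqP; rewrite -subr_eq0 -dot_eq0.
have := mxtrace_line u v; rewrite uv mxtrace_line sphere_dot expr1n.
move=> /esym/eqP; rewrite sqrf_eq1 => /orP[] /eqP d1; last by rewrite d1 ltr0N1 in d0.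
rewrite !(dotDl, dotDr, dotNl, dotNr) (dotC (set_val v)) d1 !sphere_dot.
by apply/eqP; ring.
Qed.

Lemma line_eq u v : line u = line v -> u = v \/ u = sphere_antipode v.
Proof.
move=> uv; have [d0|d0] := ltP 0 (dot (set_val u) (set_val v)).
  by left; exact: line_inj.
right; apply: line_inj; first by rewrite line_antipode.
rewrite -[set_val (sphere_antipode v)]/(- set_val v) dotNr oppr_gt0 lt_neqAle d0.
have := mxtrace_line u v; rewrite uv mxtrace_line sphere_dot expr1n andbT => d2.
by apply: contra_eqN d2 => /eqP->; rewrite expr0n /= oner_eq0.
Qed.

Lemma line_continuous : continuous line.
Proof.
move=> u; apply: (@mulmx_continuous_at _ _ _ _ _ (fun y : @sphere R n => (set_val y)^T)
  (fun y => set_val y)); last exact: set_val_continuous.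
apply: continuous_at_mx => i j.
rewrite (_ : (fun y => _) = fun y : @sphere R n => set_val y j i); last first.
  by apply/funext => y; rewrite mxE.
by apply: continuous_at_mx_coord; exact: set_val_continuous.
Qed.

(* Projecting a vector successively onto the lines [m 0, m (1/N), ...] up to
   time [t] follows the lift of the path of lines [m], up to a positive factor,
   as soon as lines at distance [1/N] in time are never orthogonal. *)
Fixpoint walk m (N : nat) (t : R) (v : 'rV[R]_n.+1) (k : nat) : 'rV[R]_n.+1 :=
  if k is k'.+1
  then walk m N t v k' *m m (Num.min (clamp t) (k'.+1%:R / N%:R)) else v.

Definition lift_path m (N : nat) x (t : R) : @sphere R n :=
  to_sphere (walk m N t (set_val x) N).

Definition fine_mesh m (N : nat) : Prop := (0 < N)%N /\
  forall s s', 0 <= s <= 1 -> 0 <= s' <= 1 -> `|s' - s| <= N%:R^-1 ->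
  0 < \tr (m s *m m s').

Lemma walkN m N t (w : 'rV[R]_n.+1) k : walk m N t (- w) k = - walk m N t w k.
Proof. by elim: k => //= k ->; rewrite mulNmx. Qed.

Section Pathwise.
Variables (m : R -> 'M[R]_n.+1) (N : nat) (x : @sphere R n).
Hypothesis mN : fine_mesh m N.
Hypothesis mL : forall s, exists u, m s = line u.
Hypothesis m0 : m 0 = line x.

Let N0 : 0 < N%:R :> R. Proof. by rewrite ltr0n; case: mN. Qed.

(** Each projection multiplies the factor by [dot u v], nonzero because consecutive times are at
    most [1/N] apart. The unit vectors are known only up to sign, so [c] is just nonzero, not
    positive. *)
Lemma walk_line t k : exists c u, [/\ c != 0,
  m (Num.min (clamp t) (k%:R / N%:R)) = line u &
  walk m N t (set_val x) k = c *: set_val u].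
Proof.
have /andP[ct0 ct1] := clamp_itv t.
have k0 j : 0 <= j%:R / N%:R :> R by rewrite divr_ge0 // ler0n.
elim: k => [|k [c [u [c0 mu wu]]]].
  exists 1, x; split; rewrite ?oner_neq0 ?scale1r //.
  by rewrite mul0r min_r.
have [v mv] := mL (Num.min (clamp t) (k.+1%:R / N%:R)).
exists (c * dot (set_val u) (set_val v)), v; split=> //.
  rewrite mulf_neq0 //; case: mN => _.
  have itv j : 0 <= Num.min (clamp t) (j%:R / N%:R) <= 1.
    by rewrite le_min ct0 k0 /= ge_min ct1.
  move=> /(_ _ _ (itv k) (itv k.+1)); rewrite mu mv mxtrace_line.
  have kS : k.+1%:R / N%:R = k%:R / N%:R + N%:R^-1 :> R.
    by rewrite -natr1 mulrDl mul1r.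
  have Ni : 0 < N%:R^-1 :> R by rewrite invr_gt0.
  (* Truncating at [clamp t] does not increase the distance between consecutive times. *)
  have /[swap]/[apply] : `|Num.min (clamp t) (k.+1%:R / N%:R) -
      Num.min (clamp t) (k%:R / N%:R)| <= N%:R^-1.
    rewrite kS; set a := clamp t; set b := k%:R / N%:R.
    by rewrite ler_norml; apply/andP; split; rewrite /Num.min;
      case: ifP; case: ifP; lra.
  by rewrite exprn_even_gt0.
by rewrite /= wu mv -scalemxAl mulmx_line scalerA.
Qed.

Lemma lift_path_line t : line (lift_path m N x t) = m (clamp t).
Proof.
have [c [u [c0 mu wu]]] := walk_line t N.
rewrite /lift_path wu line_to_sphereZ // -mu divff ?gt_eqF // min_l //.
by case/andP: (clamp_itv t).
Qed.

Lemma lift_path0 : lift_path m N x 0 = x.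
Proof.
rewrite /lift_path; suff -> : walk m N 0 (set_val x) N = set_val x.
  exact: to_sphereK.
(* Induction on the number of steps with the mesh [N] fixed: at time 0 every step is the projection
   onto the line of [x], which fixes [x]. *)
elim: {2}N => //= k ->; rewrite clamp_id ?lexx ?ler01 // min_l.
  by rewrite m0 mulmx_line sphere_dot scale1r.
by rewrite divr_ge0 // ler0n.
Qed.

Lemma lift_path_antipode t :
  lift_path m N (sphere_antipode x) t = sphere_antipode (lift_path m N x t).
Proof.
rewrite -to_sphereN; last first.
  have [c [u [c0 _ ->]]] := walk_line t N.
  by rewrite scaler_eq0 (negPf c0) /= -dot_gt0 sphere_dot ltr01.
by congr to_sphere; rewrite -walkN.
Qed.

End Pathwise.

(** The inner product of the two lifts is continuous, takes only the values 1 and -1, and starts at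
    1; the intermediate value theorem keeps it there. *)
Lemma lift_unique (f g : R -> @sphere R n) : continuous f -> continuous g ->
  (forall t, line (f t) = line (g t)) -> f 0 = g 0 -> f = g.
Proof.
move=> cf cg fg fg0; pose d t := dot (set_val (f t)) (set_val (g t)).
have cd : continuous d.
  move=> t; apply: (@dot_continuous _ _ _ (fun s => set_val (f s))
    (fun s => set_val (g s))); apply: continuous_at_set_val; [exact: cf | exact: cg].
have d2 t : d t ^+ 2 = 1.
  by rewrite -mxtrace_line fg mxtrace_line sphere_dot expr1n.
have dN0 t : d t != 0.
  by apply: contra_eqN (d2 t) => /eqP->; rewrite expr0n eq_sym oner_eq0.
have d0 : d 0 = 1 by rewrite /d fg0 sphere_dot.
have dI a b : a <= b -> Num.min (d a) (d b) <= 0 <= Num.max (d a) (d b) -> False.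
  move=> ab dab.
  have cdI : {within `[a, b], continuous d} by exact: continuous_subspaceT.
  by have [c _ /eqP] := IVT ab cdI dab; rewrite (negPf (dN0 c)).
apply/funext => t; apply: line_inj => //; rewrite -/(d t) ltNge; apply/negP => dt.
have [t0|/ltW t0] := leP 0 t.
  by apply: (dI 0 t t0); rewrite d0 ge_min dt orbT le_max ler01.
by apply: (dI t 0 t0); rewrite d0 ge_min dt le_max ler01 orbT.
Qed.

Section Family.
Context {Z : topologicalType} (M : Z -> R -> 'M[R]_n.+1).

(** On the diagonal [s' = s] the trace is 1, hence positive nearby. Compactness of [[0, 1]] yields
    one distance [d] that serves all [s] and all [z] near [z0]; the filter [F] lets [z] tend to [z0]
    and [d] to 0 from the right. *)
Lemma fine_mesh_near z0 :
  (forall s, {for (z0, s), continuous (fun p => M p.1 p.2)}) ->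
  (forall s, exists u, M z0 s = line u) ->
  exists N, \forall z \near z0, fine_mesh (M z) N.
Proof.
move=> cM mL.
pose F := filter_prod (nbhs z0) (at_right (0 : R)).
pose P (i : Z * R) (s : R) :=
  forall s', `|s' - s| <= i.2 -> 0 < \tr (M i.1 s *m M i.1 s').
have /compact_near_coveringP/(_ _ F P _)[] := @segment_compact R 0 1.
  move=> s _.
  have cphi : {for (z0, (s, s)),
      continuous (fun p => \tr (M p.1 p.2.1 *m M p.1 p.2.2))}.
    have c1 : {for (z0, (s, s)), continuous (fun p : Z * (R * R) => M p.1 p.2.1)}.
      apply: (@continuous_comp _ _ _ (fun p : Z * (R * R) => (p.1, p.2.1))
        (fun p => M p.1 p.2)); last exact: cM.
      apply: continuous_at_pair; first exact: fst_continuous.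
      by apply: (@continuous_comp _ _ _ snd fst);
        [exact: snd_continuous | exact: fst_continuous].
    have c2 : {for (z0, (s, s)), continuous (fun p : Z * (R * R) => M p.1 p.2.2)}.
      apply: (@continuous_comp _ _ _ (fun p : Z * (R * R) => (p.1, p.2.2))
        (fun p => M p.1 p.2)); last exact: cM.
      apply: continuous_at_pair; first exact: fst_continuous.
      by apply: (@continuous_comp _ _ _ snd snd); exact: snd_continuous.
    have c12 := mulmx_continuous_at c1 c2.
    have ci i : {for (z0, (s, s)),
        continuous (fun p => (M p.1 p.2.1 *m M p.1 p.2.2) i i)}.
      by move=> U nU; exact: (continuous_at_mx_coord (i := i) (j := i) c12 nU).
    exact: (@continuous_at_sum _ _ R _ _ _ ci).
  have phi0 : 0 < \tr (M z0 s *m M z0 s).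
    by have [u ->] := mL s; rewrite mxtrace_line sphere_dot expr1n ltr01.
  have c0 : {for (z0, (s, s)), continuous (fun=> 0 : R)} by exact: continuous_at_cst.
  have [[A C] /= [nA [[C1 C2] /= [nC1 nC2] CC]] AC] :=
    continuous_at_near_lt c0 cphi phi0.
  have /nbhs_ballP[e e0 eC] : nbhs s (C1 `&` C2) by exact: filterI.
  (* Half the radius is allowed for [s1] and half for its distance to [s2], so that both stay in the
     ball of radius [e]. *)
  have e20 : 0 < e / 2 by rewrite divr_gt0.
  exists (ball s (e / 2), A `*` [set d : R | d < e / 2]) => /=.
    split; first exact: nbhsx_ballx.
    by exists (A, [set d : R | d < e / 2]) => //=; split=> //; exact: nbhs_right_lt.
  move=> [s1 [z d]] /= [ss1 [Az de]] s2 s12.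
  have ss2 : ball s e s2.
    rewrite /ball /= distrC; rewrite /ball /= in ss1.
    have -> : s2 - s = (s2 - s1) + (s1 - s) by ring.
    apply: le_lt_trans (ler_normD _ _) _; rewrite (distrC s1).
    move: s12 de => /= s12 de; lra.
  have ss1' : ball s e s1.
    by apply: le_ball ss1; lra.
  apply: (AC (z, (s1, s2))); split=> //=; apply: CC; split=> /=.
    by case: (eC _ ss1').
  by case: (eC _ ss2).
move=> [A D] /= [nA nD] AD.
have [d [Dd d0]] : exists d, D d /\ 0 < d.
  have [d [Dd d0]] := filter_ex (filterI nD (nbhs_right_gt (0 : R))).
  by exists d.
(* This integer exceeds [1/d], so its inverse is at most [d]. *)
exists (Num.truncn d^-1).+1; apply: filterS nA => z Az; split=> // s s' s01 _ ss'.
apply: (AD (z, d)) => //=; apply: le_trans ss' _.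
rewrite -[leRHS]invrK lef_pV2 ?posrE ?invr_gt0 ?ltr0n //.
by apply/ltW; rewrite truncnS_gt.
Qed.

Lemma lift_path_continuous N (x : Z -> @sphere R n) z t :
  (forall s, {for (z, s), continuous (fun p => M p.1 p.2)}) ->
  (forall s, exists u, M z s = line u) -> M z 0 = line (x z) ->
  {for z, continuous x} -> fine_mesh (M z) N ->
  {for (z, t), continuous (fun p => lift_path (M p.1) N (x p.1) p.2)}.
Proof.
move=> cM mL m0 cx fN; apply: to_sphere_continuous; last first.
  have [c [u [c0 _ ->]]] := walk_line fN mL m0 t N.
  by rewrite scaler_eq0 (negPf c0) /= -dot_gt0 sphere_dot ltr01.
suff : forall k, {for (z, t),
    continuous (fun p => walk (M p.1) N p.2 (set_val (x p.1)) k)} by apply.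
elim => [|k IH] /=.
  apply: continuous_at_set_val.
  by apply: (@continuous_comp _ _ _ fst x); [exact: fst_continuous|exact: cx].
apply: mulmx_continuous_at; first exact: IH.
apply: (@continuous_comp _ _ _
  (fun p : Z * R => (p.1, Num.min (clamp p.2) (k.+1%:R / N%:R)))
  (fun p => M p.1 p.2)); last exact: cM.
apply: continuous_at_pair; first exact: fst_continuous.
apply: (@continuous_min R _ (fun p : Z * R => clamp p.2)); last exact: cvg_cst.
by apply: (@continuous_comp _ _ _ snd clamp);
  [exact: snd_continuous | exact: clamp_continuous].
Qed.

End Family.

Definition path_lift m x (t : R) : @sphere R n :=
  lift_path m (xget 0%N [set N | fine_mesh m N]) x t.

(** The mesh chosen by [xget] may jump with [z]. Near a given point one mesh [N] suits all the
    paths, and by [lift_unique] the lift made with [N], which is continuous, equals the one made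
    with the chosen mesh. *)
Lemma path_lift_continuous (Z : topologicalType) (M : Z -> R -> 'M[R]_n.+1)
  (x : Z -> @sphere R n) (O : set Z) z t : open O ->
  (forall z s, O z -> {for (z, s), continuous (fun p => M p.1 p.2)}) ->
  (forall z s, O z -> exists u, M z s = line u) ->
  (forall z, O z -> M z 0 = line (x z)) -> continuous x -> O z ->
  {for (z, t), continuous (fun p => path_lift (M p.1) (x p.1) p.2)}.
Proof.
move=> oO cM mL m0 cx Oz.
have [N nN] := fine_mesh_near (fun s => cM z s Oz) (fun s => mL z s Oz).
have nO : nbhs z O by apply: open_nbhs_nbhs.
have nNO : \forall y \near z, fine_mesh (M y) N /\ O y by exact: filterI.
apply: (@continuous_at_near_eq _ _ _
  (fun p => lift_path (M p.1) N (x p.1) p.2)); last first.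
  apply: lift_path_continuous => //;
    [by move=> s; exact: cM | by move=> s; exact: mL | exact: m0 | exact: cx |].
  exact: (nbhs_singleton nN).
apply: filterS (near_fst t nNO) => -[y s] /= [fN Oy].
rewrite /path_lift.
have fg := xgetPex 0%N
  (ex_intro _ N fN : exists N, [set N | fine_mesh (M y) N] N).
set N' := xget _ _ in fg *.
have cl K : fine_mesh (M y) K -> continuous (lift_path (M y) K (x y)).
  move=> fK s0.
  apply: (@continuous_comp _ _ _ (fun s => (y, s))
    (fun p => lift_path (M p.1) K (x p.1) p.2)).
    by apply: continuous_at_pair; [exact: cvg_cst | exact: cvg_id].
  by apply: lift_path_continuous => //;
    [move=> s'; exact: cM | move=> s'; exact: mL | exact: m0 | exact: cx].
have mLy s' : exists u, M y s' = line u by exact: mL.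
have m0y := m0 y Oy.
rewrite (lift_unique (cl _ fg) (cl _ fN)) // => [s'|].
  by rewrite !lift_path_line.
by rewrite !lift_path0.
Qed.

Lemma path_lift_line m x t : (exists N, fine_mesh m N) ->
  (forall s, exists u, m s = line u) -> m 0 = line x ->
  line (path_lift m x t) = m (clamp t).
Proof. by move=> exN mL m0; apply: lift_path_line => //; exact: (xgetPex 0%N exN). Qed.

Lemma path_lift0 m x : m 0 = line x -> path_lift m x 0 = x.
Proof. exact: lift_path0. Qed.

Lemma path_lift_antipode m x t : (exists N, fine_mesh m N) ->
  (forall s, exists u, m s = line u) -> m 0 = line x ->
  path_lift m (sphere_antipode x) t = sphere_antipode (path_lift m x t).
Proof.
by move=> exN mL m0; apply: lift_path_antipode => //; exact: (xgetPex 0%N exN).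
Qed.

End Lift.

(** * Disjoint selections of planners *)

Section Selection.
Context {R : realType} {r : nat}.
Implicit Types (B : 'M[R]_(r, 3)) (S : {set 'I_r * 'I_3}).

(* For a given cardinality at most one [S] can be dominant for [B], so the sets
   of matrices dominated by the various [S] of that cardinality are disjoint. *)
Definition dominant S B : bool :=
  [forall u in S, (0 < B u.1 u.2) &&
    [forall v, (v \notin S) ==> (B v.1 v.2 < B u.1 u.2)]] &&
  [forall i, [exists l, (i, l) \in S]].

Lemma dominant_gt0 S B u : dominant S B -> u \in S -> 0 < B u.1 u.2.
Proof. by case/andP => /forall_inP h _ /h /andP[]. Qed.

Lemma dominant_lt S B u v : dominant S B -> u \in S -> v \notin S ->
  B v.1 v.2 < B u.1 u.2.
Proof.
by case/andP => /forall_inP h _ /h /andP[_ /forallP/(_ v)/implyP]; apply.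
Qed.

(** Otherwise some [u] lies in [S] only and some [v] in [S'] only, and each of the two entries would
    be strictly larger than the other. *)
Lemma dominant_uniq S S' B : #|S| = #|S'| -> dominant S B -> dominant S' B ->
  S = S'.
Proof.
move=> cS dS dS'; apply/eqP; rewrite eqEcard cS leqnn andbT.
apply/fintype.subsetP => u uS; apply: contraT => uS'.
have /fintype.subsetPn[v vS' vS] : ~~ (S' \subset S).
  apply: contra uS' => S'S.
  by have /eqP -> : S' == S by rewrite eqEcard S'S cS leqnn.
have := lt_trans (dominant_lt dS uS vS) (dominant_lt dS' vS' uS').
by rewrite ltxx.
Qed.

Lemma dominant_near (Z : topologicalType) (b : Z -> 'M[R]_(r, 3)) z S :
  {for z, continuous b} -> dominant S (b z) ->
  \forall y \near z, dominant S (b y).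
Proof.
move=> cb dS; have cu (u : 'I_r * 'I_3) :
    {for z, continuous (fun y => b y u.1 u.2)} by exact: continuous_at_mx_coord.
have nA : \forall y \near z, forall uv : ('I_r * 'I_3) * ('I_r * 'I_3),
    uv.1 \in S -> 0 < b y uv.1.1 uv.1.2 /\
    (uv.2 \notin S -> b y uv.2.1 uv.2.2 < b y uv.1.1 uv.1.2).
  apply: (@filter_forall _ _ (fun uv : ('I_r * 'I_3) * ('I_r * 'I_3) =>
    [set y : Z | uv.1 \in S -> 0 < b y uv.1.1 uv.1.2 /\
    (uv.2 \notin S -> b y uv.2.1 uv.2.2 < b y uv.1.1 uv.1.2)])) => -[u v] /=.
  have [uS|uS] := boolP (u \in S); last exact: nearW.
  have nu : \forall y \near z, 0 < b y u.1 u.2.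
    have c0 : {for z, continuous (fun=> 0 : R)} by exact: continuous_at_cst.
    by apply: (continuous_at_near_lt c0 (cu u)); exact: dominant_gt0 dS uS.
  have [vS|vS] := boolP (v \in S); first by apply: filterS nu => y.
  have nv := continuous_at_near_lt (cu v) (cu u) (dominant_lt dS uS vS).
  by apply: filterS2 nu nv => y.
apply: filterS nA => y hy; case/andP: dS => _ dS; rewrite /dominant dS andbT.
apply/forall_inP => u uS; have [-> _] := hy (u, u) uS; apply/forallP => v.
by apply/implyP => vS; have [_] := hy (u, v) uS; exact.
Qed.

(** A dominant set meets all [r] rows, so its least possible cardinality is [r]; the offset makes
    [s] start at 0. *)
Definition stratum (s : nat) : set 'M[R]_(r, 3) :=
  [set B | exists2 S : {set 'I_r * 'I_3}, #|S| = (s + r)%N & dominant S B].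

Definition dominant_set s B : {set 'I_r * 'I_3} :=
  odflt finset.set0 [pick S : {set 'I_r * 'I_3} | (#|S| == s + r)%N && dominant S B].

Definition selection s B (i : 'I_r) : 'I_3 :=
  odflt ord0 [pick l | (i, l) \in dominant_set s B].

Lemma dominant_setE s B S : #|S| = (s + r)%N -> dominant S B ->
  dominant_set s B = S.
Proof.
move=> cS dS; rewrite /dominant_set; case: pickP => [S' /andP[/eqP cS' dS']|].
  by apply: dominant_uniq dS' dS; rewrite cS.
by move/(_ S); rewrite cS eqxx dS.
Qed.

Lemma selection_gt0 s B i : stratum s B -> 0 < B i (selection s B i).
Proof.
move=> [S cS dS]; rewrite /selection (dominant_setE cS dS).
case: pickP => [l iS|noS]; first exact: (dominant_gt0 dS iS).
by case/andP: dS => _ /forallP/(_ i)/existsP[l]; rewrite noS.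
Qed.

(** A dominant [S] remains dominant nearby, being given by finitely many strict inequalities, and is
    the only one of its cardinality. The chosen planners are thus locally constant on a stratum and
    need no interpolation. *)
Lemma selection_near (Z : topologicalType) (b : Z -> 'M[R]_(r, 3)) z s :
  {for z, continuous b} -> stratum s (b z) ->
  \forall y \near z, stratum s (b y) /\ selection s (b y) = selection s (b z).
Proof.
move=> cb [S cS dS]; apply: filterS (dominant_near cb dS) => y dS'.
split; first by exists S.
by apply/funext => i; rewrite /selection !(dominant_setE cS).
Qed.

(** With [c] the least of the row maxima, the entries at least [c] form a dominant set. It contains
    a maximal entry of each row, hence at least [r] elements, and only positive entries, hence at
    most [m i + 1] in row [i]. *)
Lemma stratum_cover (m : 'I_r -> nat) B : (0 < r)%N ->
  (forall i, exists l, 0 < B i l) ->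
  (forall i (l : 'I_3), (m i < l)%N -> B i l <= 0) ->
  exists2 s, (s <= \sum_i m i)%N & stratum s B.
Proof.
move=> r0 Bgt0 Bm; pose i0 := Ordinal r0.
have [best bestP] : exists best : 'I_r -> 'I_3,
    forall i l, B i l <= B i (best i).
  exists (fun i => [arg max_(l > ord0) B i l]%O) => i l.
  by case: (@arg_maxP _ _ _ ord0 xpredT) => // k _; exact.
have [j jP] : exists j, forall i, B j (best j) <= B i (best i).
  exists [arg min_(i < i0) B i (best i)]%O => i.
  by case: (@arg_minP _ _ _ i0 xpredT) => // k _; exact.
pose c := B j (best j).
have c0 : 0 < c by have [l Bl] := Bgt0 j; exact: lt_le_trans Bl (bestP j l).
pose S : {set 'I_r * 'I_3} := [set u | c <= B u.1 u.2]%SET.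
have dS : dominant S B.
  apply/andP; split.
    apply/forall_inP => u; rewrite inE => cu; rewrite (lt_le_trans c0 cu).
    apply/forallP => v; apply/implyP; rewrite inE -ltNge => vc.
    exact: lt_le_trans vc cu.
  by apply/forallP => i; apply/existsP; exists (best i); rewrite inE; exact: jP.
have rS : (r <= #|S|)%N.
  rewrite -{1}(card_ord r) -cardsT.
  have fI : injective (fun i => (i, best i)) by move=> i k [].
  rewrite -(card_imset _ fI) subset_leq_card //.
  by apply/fintype.subsetP => _ /imsetP[i _ ->]; rewrite inE; exact: jP.
have Sm : (#|S| <= \sum_i m i + r)%N.
  have -> : (\sum_i m i + r = \sum_i (m i).+1)%N.
    rewrite -[X in (_ + X)%N](card_ord r) -sum1_card -big_split /=.
    by apply: eq_bigr => i _; rewrite addn1.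
  rewrite -sum1_card big_mkcond /=.
  apply: (@leq_trans (\sum_i \sum_(l < 3) (l <= m i)%N)).
    rewrite pair_big /=; apply: leq_sum => -[i l] _ /=.
    rewrite inE /=; case: ifP => // cl; case: (leqP l (m i)) => // ml.
    by have := Bm i l ml; rewrite leNgt (lt_le_trans c0 cl).
  apply: leq_sum => i _; rewrite !big_ord_recr big_ord0 /=.
  by case: (m i) => [|[|k]].
exists (#|S| - r)%N; first by rewrite leq_subLR addnC.
by exists S => //; rewrite subnK.
Qed.

End Selection.

(** * Planners on projective product spaces *)

Section ProductPlanner.
Context {R : realType} {r : nat} (ns : 'I_r -> nat) (i0 : 'I_r).
Hypothesis ns_gt0 : forall i, (0 < ns i)%N.
Local Notation X := (@sphere_prod R r ns).
Local Notation a := (@prod_antipode R r ns).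

Variables (O : set (X * X)) (h : X * X -> R -> @sphere R (ns i0)).
Hypothesis oO : open O.
Hypothesis Ol : forall x y, O (x, y) -> O (a x, y).
Hypothesis Or : forall x y, O (x, y) -> O (x, a y).
Hypothesis ch : forall z t, O z -> {for (z, t), continuous (fun p => h p.1 p.2)}.
Hypothesis h0 : forall z, O z -> h z 0 = z.1 i0.
Hypothesis h1 : forall z, O z -> h z 1 = z.2 i0 \/ h z 1 = sphere_antipode (z.2 i0).
Hypothesis hl : forall x y t, O (x, y) ->
  h (a x, y) t = sphere_antipode (h (x, y) t).
Hypothesis hr : forall x y t, O (x, y) -> h (x, a y) t = h (x, y) t.

Definition end_sign (z : X * X) : R := dot (set_val (h z 1)) (set_val (z.2 i0)).

(* The representative of the class of [z.2] that [h] heads for. *)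
Definition target (z : X * X) : X := if 0 < end_sign z then z.2 else a z.2.

Lemma end_signP z : O z ->
  end_sign z = 1 /\ h z 1 = z.2 i0 \/
  end_sign z = -1 /\ h z 1 = sphere_antipode (z.2 i0).
Proof.
move=> Oz; rewrite /end_sign; have [->|->] := h1 Oz; [left|right]; split=> //.
  exact: sphere_dot.
rewrite -[set_val (sphere_antipode _)]/(- set_val _) dotNl.
by congr (- _); exact: sphere_dot.
Qed.

Lemma target_i0 z : O z -> h z 1 = target z i0.
Proof.
move=> Oz; rewrite /target.
by have [[-> ->]|[-> ->]] := end_signP Oz; rewrite ?ltr01 ?ltr0N1.
Qed.

Lemma end_signl x y : O (x, y) -> end_sign (a x, y) = - end_sign (x, y).
Proof.
move=> Oxy; rewrite /end_sign hl // -dotNl.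
by congr dot.
Qed.

Lemma end_signr x y : O (x, y) -> end_sign (x, a y) = - end_sign (x, y).
Proof.
move=> Oxy; rewrite /end_sign hr // -dotNr.
by congr dot.
Qed.

(** Reversing [x] reverses the whole lift, and with it the end point that decides the target. *)
Lemma targetl x y : O (x, y) -> target (a x, y) = a (target (x, y)).
Proof.
move=> Oxy; rewrite /target end_signl //=.
by have [[-> _]|[-> _]] := end_signP Oxy; rewrite ?opprK ?ltr01 ?ltr0N1 ?prod_antipodeK.
Qed.

(** The sign changes of [y] and of [end_sign] cancel. *)
Lemma targetr x y : O (x, y) -> target (x, a y) = target (x, y).
Proof.
move=> Oxy; rewrite /target end_signr //=.
by have [[-> _]|[-> _]] := end_signP Oxy; rewrite ?opprK ?ltr01 ?ltr0N1 ?prod_antipodeK.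
Qed.

Lemma end_sign_continuous z : O z -> {for z, continuous end_sign}.
Proof.
move=> Oz.
apply: (@dot_continuous R _ _ (fun z => set_val (h z 1)) (fun z => set_val (z.2 i0))).
  apply: continuous_at_set_val.
  apply: (@continuous_comp _ _ _ (fun z => (z, 1 : R)) (fun p => h p.1 p.2)).
    by apply: continuous_at_pair; [exact: cvg_id | exact: cvg_cst].
  exact: ch.
apply: continuous_at_set_val.
apply: (@continuous_comp _ _ _ snd (fun x : X => x i0)); first exact: snd_continuous.
exact: sphere_prod_coord_continuous.
Qed.

(** [end_sign] is continuous with values 1 and -1 on [O], so the case chosen in [target] is locally
    constant. *)
Lemma target_continuous z : O z -> {for z, continuous target}.
Proof.
move=> Oz; have cs := end_sign_continuous Oz.
have c0 : {for z, continuous (fun=> 0 : R)} by exact: continuous_at_cst.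
have [[e _]|[e _]] := end_signP Oz.
  have z0 : 0 < end_sign z by rewrite e ltr01.
  apply: (@continuous_at_near_eq _ _ _ snd); last exact: snd_continuous.
  by apply: filterS (continuous_at_near_lt c0 cs z0) => y y0; rewrite /target y0.
have z0 : end_sign z < 0 by rewrite e ltrN10.
apply: (@continuous_at_near_eq _ _ _ (a \o snd)).
  apply: filterS (continuous_at_near_lt cs c0 z0) => y y0.
  by rewrite /target ltNge (ltW y0).
apply: continuous_comp; first exact: snd_continuous.
exact: prod_antipode_continuous.
Qed.

(* The constant row [i0] counts [h] as a planner defined everywhere on [O]. *)
Definition weight_mx (z : X * X) : 'M[R]_(r, 3) :=
  \matrix_(i, l) if i == i0 then (l == ord0)%:R
    else weight l (set_val (z.1 i)) (set_val (target z i)).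

(** One less than the number of planners in row [i], that is, the last column that can carry a
    positive weight. *)
Definition planner_count (i : 'I_r) : nat :=
  if i == i0 then 0%N else (~~ odd (ns i)).+1.

Lemma weight_mx_continuous z : O z -> {for z, continuous weight_mx}.
Proof.
move=> Oz; apply: continuous_at_mx => i l.
have c2 : {for z, continuous (fun y => set_val (target y i))}.
  apply: continuous_at_set_val.
  apply: (@continuous_comp _ _ _ target (fun x : X => x i)).
    exact: target_continuous.
  exact: sphere_prod_coord_continuous.
have c1 : {for z, continuous (fun y : X * X => set_val (y.1 i))}.
  apply: continuous_at_set_val.
  apply: (@continuous_comp _ _ _ fst (fun x : X => x i)).
    exact: fst_continuous.
  exact: sphere_prod_coord_continuous.
rewrite (_ : (fun y => _) = fun y => if i == i0 then (l == ord0)%:R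
    else weight l (set_val (y.1 i)) (set_val (target y i))); last first.
  by apply/funext => y; rewrite mxE.
by case: (i == i0); [exact: continuous_at_cst | exact: weight_continuous c1 c2].
Qed.

Lemma weight_mxl x y : O (x, y) -> weight_mx (a x, y) = weight_mx (x, y).
Proof.
move=> Oxy; apply/matrixP => i l; rewrite !mxE targetl //=.
case: ifP => // _; rewrite -[RHS]weightNN.
by congr weight.
Qed.

Lemma weight_mxr x y : O (x, y) -> weight_mx (x, a y) = weight_mx (x, y).
Proof. by move=> Oxy; apply/matrixP => i l; rewrite !mxE targetr. Qed.

Lemma weight_mx_cover z :
  exists2 s, (s <= \sum_i planner_count i)%N & stratum s (weight_mx z).
Proof.
apply: stratum_cover => [|i|i l].
- exact: leq_ltn_trans (leq0n i0) (ltn_ord i0).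
- have [->|ii0] := eqVneq i i0.
    by exists ord0; rewrite mxE !eqxx ltr01.
  have [l l3 wl] := @weight_cover R (ns i) (set_val (z.1 i)) (set_val (target z i))
    (sphere_dot _) (sphere_dot _).
  have l3' : (l < 3)%N by apply: leq_trans l3 _; case: (odd _).
  by exists (Ordinal l3'); rewrite mxE (negPf ii0).
- rewrite /planner_count mxE; case: ifP => _.
    by case: l => -[|l] // l3 _; rewrite (_ : _ == _ = false).
  by move=> ml; rewrite weight_oob // -leqNgt add2n.
Qed.

Definition product_path s (z : X * X) (t : R) : X :=
  eqtype.dfwith (fun i => sphere_path (selection s (weight_mx z) i) (z.1 i) (target z i) t)
    (h z t).

Definition product_domain s : set (X * X) :=
  [set z | O z /\ stratum s (weight_mx z)].

Lemma product_domain_near s z : product_domain s z -> \forall y \near z,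
  product_domain s y /\ selection s (weight_mx y) = selection s (weight_mx z).
Proof.
move=> [Oz sz]; have nO : nbhs z O by apply: open_nbhs_nbhs.
have nS := selection_near (weight_mx_continuous Oz) sz.
by apply: filterS2 nO nS => y Oy [sy ey]; split; [split|].
Qed.

Lemma product_domain_open s : open (product_domain s).
Proof.
by rewrite openE => z /product_domain_near; apply: filterS => y [].
Qed.

Lemma product_weight_gt0 s z i : product_domain s z -> i0 != i ->
  0 < weight (selection s (weight_mx z) i) (set_val (z.1 i)) (set_val (target z i)).
Proof.
move=> [_ sz] ii0; have := selection_gt0 i sz.
by rewrite {1}/weight_mx mxE eq_sym (negPf ii0).
Qed.

Lemma product_path_continuous s z t : product_domain s z ->
  {for (z, t), continuous (fun p => product_path s p.1 p.2)}.
Proof.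
move=> Dz; have [Oz _] := Dz; apply: continuous_at_prod => i.
have [<-|ii0] := eqVneq i0 i.
  rewrite (_ : (fun p => _) = fun p => h p.1 p.2); first exact: ch.
  by apply/funext => p; rewrite /product_path dfwith_in.
(* Near [z] the selected planner is frozen at its value at [z], so continuity of a single
   [sphere_path] suffices. *)
apply: (@continuous_at_near_eq (X * X * R)%type (@sphere R (ns i))
  (fun p => product_path s p.1 p.2 i) (fun p =>
  sphere_path (selection s (weight_mx z) i) (p.1.1 i) (target p.1 i) p.2)).
  have nD : \forall y \near z, selection s (weight_mx y) = selection s (weight_mx z).
    by apply: filterS (product_domain_near Dz) => y [].
  apply: filterS (near_fst t nD) => p ps.
  by rewrite /product_path (dfwith_out _ _ ii0) ps.
apply: (@sphere_path_continuous R _ (ns_gt0 i) (X * X * R)%type _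
  (fun p => p.1.1 i) (fun p => target p.1 i) snd).
- apply: (@continuous_comp _ _ _ fst (fun y : X * X => y.1 i)).
    exact: fst_continuous.
  apply: (@continuous_comp _ _ _ fst (fun x : X => x i)).
    exact: fst_continuous.
  exact: sphere_prod_coord_continuous.
- apply: (@continuous_comp _ _ _ fst (fun y : X * X => target y i)).
    exact: fst_continuous.
  apply: (@continuous_comp _ _ _ target (fun x : X => x i)).
    exact: target_continuous.
  exact: sphere_prod_coord_continuous.
- exact: snd_continuous.
- exact: (product_weight_gt0 Dz ii0).
Qed.

Lemma product_path0 s z : product_domain s z -> product_path s z 0 = z.1.
Proof.
move=> [Oz _]; apply: functional_extensionality_dep => i; rewrite /product_path.
have [<-|ii0] := eqVneq i0 i; first by rewrite dfwith_in h0.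
by rewrite (dfwith_out _ _ ii0) sphere_path0.
Qed.

Lemma product_path1 s z : product_domain s z ->
  product_path s z 1 = z.2 \/ product_path s z 1 = a z.2.
Proof.
move=> [Oz _]; suff -> : product_path s z 1 = target z.
  by rewrite /target; case: ifP; [left | right].
apply: functional_extensionality_dep => i; rewrite /product_path.
have [<-|ii0] := eqVneq i0 i; first by rewrite dfwith_in target_i0.
by rewrite (dfwith_out _ _ ii0) sphere_path1.
Qed.

Lemma product_pathl s x y t : product_domain s (x, y) ->
  product_path s (a x, y) t = a (product_path s (x, y) t).
Proof.
move=> D; have [Oxy _] := D; apply: functional_extensionality_dep => i.
rewrite /product_path [RHS]/prod_antipode weight_mxl // targetl //=.
have [<-|ii0] := eqVneq i0 i; first by rewrite !dfwith_in hl.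
rewrite !(dfwith_out _ _ ii0) -(@sphere_pathNN R _ (ns_gt0 i)); first by [].
exact: product_weight_gt0 D ii0.
Qed.

Lemma product_pathr s x y t : product_domain s (x, y) ->
  product_path s (x, a y) t = product_path s (x, y) t.
Proof.
by move=> [Oxy _]; rewrite /product_path weight_mxr // targetr // hr.
Qed.

Lemma product_planner s :
  open (@antip_image X a (@prod_antipodeK R r ns) (product_domain s)) /\
  @has_motion_planner R (@Pbar R r ns)
    (@antip_image X a (@prod_antipodeK R r ns) (product_domain s)).
Proof.
have Dl x y : product_domain s (x, y) -> product_domain s (a x, y).
  by move=> [Oxy sxy]; split; [exact: Ol | rewrite weight_mxl].
have Dr x y : product_domain s (x, y) -> product_domain s (x, a y).
  by move=> [Oxy sxy]; split; [exact: Or | rewrite weight_mxr].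
have ca := @prod_antipode_continuous R r ns.
split.
  by apply: antip_image_open => //; exact: product_domain_open.
apply: (@antip_image_planner R _ _ _ ca _ (product_path s)) => //.
- exact: product_domain_open.
- by move=> z t; exact: product_path_continuous.
- exact: product_path0.
- exact: product_path1.
- exact: product_pathl.
- exact: product_pathr.
Qed.

End ProductPlanner.

(** * From a planner on real projective space to planners on the product space *)

Section Lifting.
Context {R : realType} {r : nat} (ns : 'I_r -> nat) (i0 : 'I_r).
Hypothesis ns_gt0 : forall i, (0 < ns i)%N.
Local Notation X := (@sphere_prod R r ns).
Local Notation a := (@prod_antipode R r ns).
Local Notation piS := (antip_pi (@sphere_antipodeK R (ns i0))).
Local Notation piX := (antip_pi (@prod_antipodeK R r ns)).

Definition base_pair (z : X * X) : @RP R (ns i0) * @RP R (ns i0) :=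
  (piS (z.1 i0), piS (z.2 i0)).

Lemma base_pairl x y : base_pair (a x, y) = base_pair (x, y).
Proof. by rewrite /base_pair /= antip_piA. Qed.

Lemma base_pairr x y : base_pair (x, a y) = base_pair (x, y).
Proof. by rewrite /base_pair /= antip_piA. Qed.

Lemma base_pair_continuous : continuous base_pair.
Proof.
move=> z; apply: (@continuous_at_pair (X * X)%type _ _
  (fun y => piS (y.1 i0)) (fun y => piS (y.2 i0))).
  apply: (@continuous_comp _ _ _ (fun y : X * X => y.1 i0) piS).
    apply: (@continuous_comp _ _ _ fst (fun x : X => x i0)).
      exact: fst_continuous.
    exact: sphere_prod_coord_continuous.
  exact: antip_pi_continuous.
apply: (@continuous_comp _ _ _ (fun y : X * X => y.2 i0) piS).
  apply: (@continuous_comp _ _ _ snd (fun x : X => x i0)).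
    exact: snd_continuous.
  exact: sphere_prod_coord_continuous.
exact: antip_pi_continuous.
Qed.

Lemma line_repr (x : @sphere R (ns i0)) : line (repr (piS x)) = line x.
Proof.
by have [->|->] := antip_repr (@sphere_antipodeK R (ns i0)) x;
  rewrite ?line_antipode.
Qed.

Lemma planner_cover (U : set (@RP R (ns i0) * @RP R (ns i0))) :
  open U -> @has_motion_planner R (@RP R (ns i0)) U ->
  exists V : nat -> set (@Pbar R r ns * @Pbar R r ns),
    (forall s, open (V s) /\ @has_motion_planner R (@Pbar R r ns) (V s)) /\
    (forall u, U (base_pair (repr u.1, repr u.2)) ->
      exists2 s, (s <= \sum_i planner_count ns i0 i)%N & V s u).
Proof.
move=> oU pU; have [H [cH HE]] := motion_planner_homotopy oU pU.
pose O : set (X * X) := base_pair @^-1` U.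
have oO : open O by move/continuousP: base_pair_continuous; exact.
(* [repr] is not continuous, but [line] does not distinguish the two representatives, so the
   composite is. *)
pose M (z : X * X) (s : R) := line (repr (H (base_pair z) s)).
have cM z s : O z -> {for (z, s), continuous (fun p => M p.1 p.2)}.
  move=> Oz.
  apply: (@continuous_comp _ _ _ (fun p => H (base_pair p.1) p.2)
    (fun p => line (repr p))).
    apply: (@continuous_comp _ _ _ (fun p : X * X * R => (base_pair p.1, p.2))
      (fun p => H p.1 p.2)); last exact: cH.
    apply: continuous_at_pair; last exact: snd_continuous.
    apply: (@continuous_comp _ _ _ fst base_pair); first exact: fst_continuous.
    exact: base_pair_continuous.
  apply: (@antip_repr_continuous _ _ (@sphere_antipodeK R (ns i0)) _ line).
    exact: line_continuous.
  exact: line_antipode.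
have mL z s : O z -> exists u, M z s = line u.
  by move=> _; exists (repr (H (base_pair z) s)).
have m0 z : O z -> M z 0 = line (z.1 i0).
  by move=> Oz; rewrite /M (HE _ Oz).1 line_repr.
have m1 z : O z -> M z 1 = line (z.2 i0).
  by move=> Oz; rewrite /M (HE _ Oz).2 line_repr.
have Mfine z : O z -> exists N, fine_mesh (M z) N.
  move=> Oz; have [N nN] := fine_mesh_near (fun s => cM z s Oz) (fun s => mL z s Oz).
  by exists N; exact: nbhs_singleton nN.
pose h (z : X * X) (t : R) := path_lift (M z) (z.1 i0) t.
have Ol x y : O (x, y) -> O (a x, y) by rewrite /O /preimage /= base_pairl.
have Or x y : O (x, y) -> O (x, a y) by rewrite /O /preimage /= base_pairr.
have ch z t : O z -> {for (z, t), continuous (fun p => h p.1 p.2)}.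
  move=> Oz; apply: (path_lift_continuous (x := fun z : X * X => z.1 i0) oO cM mL m0 _ Oz).
  move=> y; apply: (@continuous_comp _ _ _ fst (fun x : X => x i0)).
    exact: fst_continuous.
  exact: sphere_prod_coord_continuous.
have h0 z : O z -> h z 0 = z.1 i0 by move=> Oz; exact: path_lift0 (m0 z Oz).
have h1 z : O z -> h z 1 = z.2 i0 \/ h z 1 = sphere_antipode (z.2 i0).
  move=> Oz; apply: line_eq; rewrite -(m1 z Oz).
  rewrite (path_lift_line _ (Mfine z Oz) (fun s => mL z s Oz) (m0 z Oz)).
  by rewrite clamp_id // lexx ler01.
(* The path of lines depends on the classes only; just the starting point of the lift changes
   sign. *)
have hl x y t : O (x, y) -> h (a x, y) t = sphere_antipode (h (x, y) t).
  move=> Oxy; rewrite /h -(path_lift_antipode _ (Mfine _ Oxy)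
    (fun s => mL _ s Oxy) (m0 _ Oxy)).
  by rewrite /M base_pairl.
have hr x y t : O (x, y) -> h (x, a y) t = h (x, y) t.
  by move=> Oxy; rewrite /h /M base_pairr.
exists (fun s => @antip_image X a (@prod_antipodeK R r ns) (product_domain O h s)).
split=> [s|u Ou].
  exact: product_planner.
have [s sm ss] := weight_mx_cover h (repr u.1, repr u.2).
by exists s => //; split.
Qed.

End Lifting.

(** The successor supplies the unit that row [i0] contributes to [r]; every other row gives 1, and
    one more, counted by [k], when its dimension is even. *)
Lemma sum_planner_count (r : nat) (ns : 'I_r -> nat) (hr : (0 < r)%N) :
  (\sum_i planner_count ns (Ordinal hr) i).+1 =
  (r + #|[set i : 'I_r | (1 <= i)%N && ~~ odd (ns i)]%SET|)%N.
Proof.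
set i0 := Ordinal hr.
have i0E (i : 'I_r) : (i != i0) = (1 <= i)%N.
  by rewrite -val_eqE /= lt0n.
set K := #|_|; transitivity (\sum_(i < r) 1 + K)%N; last first.
  by rewrite sum1_card card_ord.
rewrite /K -sum1_card (bigD1 i0) //= [in RHS](bigD1 i0) //=.
rewrite {1}/planner_count eqxx add0n add1n addSn; congr _.+1.
rewrite [X in _ = (_ + X)%N](eq_bigl (fun i => (i != i0) && ~~ odd (ns i))).
  rewrite big_mkcondr -big_split /=; apply: eq_bigr => i ii0.
  by rewrite /planner_count (negPf ii0); case: odd.
by move=> i; rewrite inE i0E.
Qed.

Local Close Scope ring_scope.
Local Close Scope classical_set_scope.
Local Close Scope quotient_scope.

(* n̄ = (n_1,...,n_r) is ns : 'I_r -> nat (0-based: n_{i+1} = ns i);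
   k = #{ i : 2 <= i <= r (1-based), n_i even } *)
Theorem theorem3p9 (R : realType) (r : nat) (ns : 'I_r -> nat)
  (hr : (0 < r)%N)
  (h1 : (1 <= ns (Ordinal hr))%N)
  (hmono : forall i j : 'I_r, (i <= j)%N -> (ns i <= ns j)%N) :
  let k := #|[set i : 'I_r | (1 <= i)%N && ~~ odd (ns i)]| in
  forall t : nat, @is_TC R (@RP R (ns (Ordinal hr))) t ->
  exists m : nat, (m < t.+1 * (r + k))%N /\ @is_TC R (@Pbar R r ns) m.
Proof.
move=> k t [[U [oU [cU pU]]] _].
have ns_gt0 i : (0 < ns i)%N by apply: leq_trans h1 (hmono _ _ _).
have [V VP] := choice (fun j => planner_cover ns_gt0 (oU j) (pU j)).
have N0 : (0 < t.+1 * (r + k))%N by rewrite muln_gt0 addn_gt0 hr.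
(* The reduced invariant is one less than the number of open sets: hence the predecessor here and
   the strict inequality in the conclusion. *)
have le_m : @TC_le R (@Pbar R r ns) (t.+1 * (r + k)).-1.
  apply: (@TC_le_finType _ _ _ ('I_t.+1 * 'I_(r + k))%type (fun js => V js.1 js.2)).
  - by rewrite card_prod !card_ord prednK.
  - by move=> js; exact: ((VP js.1).1 js.2).1.
  - move=> u.
    have [j _ Uj] : exists2 j, setT j & U j (base_pair (Ordinal hr) (repr u.1, repr u.2)).
      suff : (\bigcup_(i in [set: 'I_t.+1]) U i)%classic
          (base_pair (Ordinal hr) (repr u.1, repr u.2)) by [].
      by rewrite cU.
    have [s sm Vs] := (VP j).2 u Uj.
    have sk : (s < r + k)%N by rewrite -(sum_planner_count ns hr) ltnS.
    by exists (j, Ordinal sk).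
  - by move=> js; exact: ((VP js.1).1 js.2).2.
have [m [mN TCm]] := TC_le_is_TC le_m.
by exists m; split=> //; rewrite -(prednK N0) ltnS.
Qed.
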